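(* Let $m\ge 1$, $1\le p<\infty$, and let $U\subset F_B(\mathbb{R}^m)$. Let $\overline{U}$ denote the closure of $U$ in $(F_B(\mathbb{R}^m)^p,d_p)$. Then $U$ is relatively compact in $(F_B(\mathbb{R}^m), d_p)$ if and only if (i) $U$ is uniformly $p$-mean bounded; (ii) $U$ is $p$-mean equi-left-continuous; and (iii) $\overline{U}\subset F_B(\mathbb{R}^m)$.
   Context: $H$ is the Hausdorff metric on nonempty closed subsets of $\mathbb{R}^m$ (Euclidean distance): $H(A,B)=\max\{\sup_{a\in A}\inf_{b\in B}d(a,b),\ \sup_{b\in B}\inf_{a\in A}d(a,b)\}$ (possibly $+\infty$). A fuzzy set on $\mathbb{R}^m$ is a function $u:\mathbb{R}^m\to[0,1]$; its cuts are $[u]_\alpha=\{x: u(x)\ge\alpha\}$ for $\alpha\in(0,1]$ and $[u]_0=\overline{\{x: u(x)>0\}}$. $F_B(\mathbb{R}^m)$ is the set of fuzzy sets $u$ on $\mathbb{R}^m$ that are normal ($u(x_0)=1$ for some $x_0$), upper semi-continuous, and have $[u]_0$ bounded. $F_B(\mathbb{R}^m)^p\supset F_B(\mathbb{R}^m)$ is the set of normal upper semi-continuous fuzzy sets $u$ with $\left(\int_0^1 H([u]_\alpha,\{0\})^p\,d\alpha\right)^{1/p}<+\infty$, where $0$ is the origin. The metric on both is $d_p(u,v)=\left(\int_0^1 H([u]_\alpha,[v]_\alpha)^p\,d\alpha\right)^{1/p}$. A set $U\subset F_B(\mathbb{R}^m)^p$ is uniformly $p$-mean bounded if there is $M>0$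 with $d_p(u,\widehat{0})\le M$ for all $u\in U$, where $\widehat 0$ is the characteristic function of $\{0\}$. $U$ is $p$-mean equi-left-continuous if for every $\varepsilon>0$ there is $\delta>0$ such that for all $0\le h<\delta$ and all $u\in U$, $\left(\int_h^1 H([u]_\alpha,[u]_{\alpha-h})^p\,d\alpha\right)^{1/p}<\varepsilon$. A subset of a metric space $X$ is relatively compact in $X$ if its closure in $X$ is compact. *)

(* Defs.v *)
From HB Require Import structures.
From mathcomp Require Import all_boot all_order all_algebra.
From mathcomp Require Import all_classical all_reals all_analysis.

Set Implicit Arguments.
Unset Strict Implicit.
Unset Printing Implicit Defensive.

Import Order.TTheory GRing.Theory Num.Theory.
Import numFieldNormedType.Exports.

Local Open Scope classical_set_scope.
Local Open Scope ring_scope.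
Local Open Scope ereal_scope.

(* [T] equipped with the topology whose open sets are the [O] containing, with
   each of their points [x], some ball [[set y | d x y < e]].  This is always
   a topology, and it is the metric topology when [d] is a metric. *)
Definition metric_top (R : realType) (T : Type) (d : T -> T -> \bar R) : Type :=
  T.

Section MetricTop.
Context {R : realType} {T : Type} (d : T -> T -> \bar R).

Definition metric_open (O : set (metric_top d)) : Prop :=
  forall x, O x ->
    exists2 e : R, (0 < e)%R & forall y, d x y < e%:E -> O y.

Let metric_openT : metric_open setT.
Proof. by move=> x _; exists 1%R. Qed.

Let metric_openI : setI_closed metric_open.
Proof.
move=> A B oA oB x [/oA[e e0 eA] /oB[f f0 fB]].
exists (Num.min e f) => [|y]; first by rewrite lt_min e0 f0.
by rewrite EFin_min lt_min => /andP[/eA ? /fB ?].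
Qed.

Let metric_open_bigU (I : Type) (f : I -> set (metric_top d)) :
  (forall i, metric_open (f i)) -> metric_open (\bigcup_i f i).
Proof.
move=> of_ x [i _ /of_[e e0 fe]]; exists e => // y /fe fy.
by exists i.
Qed.

HB.instance Definition _ := gen_eqMixin (metric_top d).
HB.instance Definition _ := gen_choiceMixin (metric_top d).
HB.instance Definition _ := @isOpenTopological.Build (metric_top d)
  metric_open metric_openT metric_openI metric_open_bigU.

End MetricTop.

(* The library norm of ['rV[R]_m] is the sup norm, so the Euclidean distance is
   defined here.  Both induce the library topology of ['rV[R]_m], which is the
   one used below for closures and semicontinuity. *)
Definition euclid_dist (R : realType) (m : nat) (x y : 'rV[R]_m) : R :=
  Num.sqrt (\sum_(i < m) (x ord0 i - y ord0 i) ^+ 2)%R.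

Definition hausdorff (R : realType) (m : nat) (A B : set 'rV[R]_m) : \bar R :=
  maxe
    (ereal_sup [set ereal_inf [set (euclid_dist a b)%:E | b in B] | a in A])
    (ereal_sup [set ereal_inf [set (euclid_dist a b)%:E | a in A] | b in B]).

Section FuzzySets.
Context {R : realType} {m : nat}.
Implicit Types (u v : 'rV[R]_m -> R) (U X : set ('rV[R]_m -> R)).
Implicit Types (p h : R).

Definition fuzzy_set u : Prop := forall x, (0 <= u x <= 1)%R.

(* Only levels [a] in [0, 1] are meaningful. *)
Definition level_cut u (a : R) : set 'rV[R]_m :=
  if a == 0%R then closure [set x | (0 < u x)%R] else [set x | (a <= u x)%R].

Definition normal_fuzzy u : Prop := exists x, u x = 1%R.

Definition upper_semicontinuous u : Prop :=
  forall (x : 'rV[R]_m) (a : R), (u x < a)%R -> \forall y \near x, (u y < a)%R.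

Definition euclid_bounded (A : set 'rV[R]_m) : Prop :=
  exists M : R, forall x, A x -> (euclid_dist x 0%R <= M)%R.

Definition FB : set ('rV[R]_m -> R) :=
  [set u | [/\ fuzzy_set u, normal_fuzzy u, upper_semicontinuous u
             & euclid_bounded (level_cut u 0%R)]].

Definition FBp p : set ('rV[R]_m -> R) :=
  [set u | [/\ fuzzy_set u, normal_fuzzy u, upper_semicontinuous u
             & (\int[lebesgue_measure]_(a in `[0%R, 1%R])
                  hausdorff (level_cut u a) [set 0%R] `^ p) `^ p^-1 < +oo]].

Definition dp p u v : \bar R :=
  (\int[lebesgue_measure]_(a in `[0%R, 1%R])
     hausdorff (level_cut u a) (level_cut v a) `^ p) `^ p^-1.

Definition fuzzy_zero : 'rV[R]_m -> R := \1_[set 0%R].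

Definition p_mean_bounded p U : Prop :=
  exists2 M : R, (0 < M)%R & forall u, U u -> dp p u fuzzy_zero <= M%:E.

Definition p_mean_equi_left_continuous p U : Prop :=
  forall e : R, (0 < e)%R ->
    exists2 delta : R, (0 < delta)%R &
      forall h u, (0 <= h < delta)%R -> U u ->
        (\int[lebesgue_measure]_(a in `[h, 1%R])
           hausdorff (level_cut u a) (level_cut u (a - h)%R) `^ p) `^ p^-1 < e%:E.

Definition dp_space p X : Type :=
  metric_top (fun u v : set_type X => dp p (\val u) (\val v)).

(* For [U `<=` X], [dp_trace p X U] is [U] as a set of points of
   [(X, d_p)]. *)
Definition dp_trace p X U : set (dp_space p X) :=
  [set u : set_type X | U (\val u)].

Arguments dp_trace : clear implicits.

Definition dp_closure p X U : set ('rV[R]_m -> R) :=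
  [set \val (u : set_type X) | u in closure (dp_trace p X U)].

Definition dp_relatively_compact p X U : Prop :=
  compact (closure (dp_trace p X U)).

End FuzzySets.

Arguments FB R m : clear implicits.
Arguments FBp R m p : clear implicits.
Arguments dp_trace {R m} p X U.

(* Main.v *)
(** The necessity of (i)-(iii) is a cluster-point argument: a violation of one
    of them yields a decreasing family of nonempty subsets of [U], which
    clusters at some [w] in [FB]; the Minkowski inequality transfers to nearby
    [u] the bound on [dp w 0], resp. on the left modulus of [w] (small by
    dominated convergence), and uniqueness of limits gives (iii).

    For sufficiency, take an ultrafilter on the closure of [U].  By (i) all
    cuts at a fixed positive level lie in a common ball, so they have an
    ultralimit in the Hausdorff metric (Blaschke selection), and these limits
    are essentially the cuts of a fuzzy set [w].  Controlling finitely many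
    levels shows that, along the ultrafilter, [u] and [w] are interleaved: each
    cut of one is contained up to [e] in the cut of the other [s] levels below.
    Interleaving turns (i) and (ii) for [u] into the same properties of [w],
    and then (ii) for both bounds [dp u w]; no subsequence and no almost
    everywhere convergence is needed.  Finally [w] is in [FB] by (iii). *)

Require Import Defs.
From mathcomp Require Import all_boot all_order all_algebra.
From mathcomp Require Import all_classical all_reals all_analysis.
From mathcomp Require Import measurable_realfun ring lra.

Set Implicit Arguments.
Unset Strict Implicit.
Unset Printing Implicit Defensive.

Import Order.TTheory GRing.Theory Num.Theory.
Import numFieldNormedType.Exports.

Local Open Scope classical_set_scope.
Local Open Scope ring_scope.

(** * The functional (int_D f^p)^(1/p) *)

Section PowerNorm.
Context d (T : measurableType d) (R : realType).
Variables (mu : {measure set T -> \bar R}) (p : R).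
Hypothesis p1 : 1 <= p.
Implicit Types (D A B : set T) (f g h : T -> \bar R).
Local Open Scope ereal_scope.

Definition pnorm D f : \bar R := (\int[mu]_(x in D) f x `^ p) `^ p^-1.

Let p_gt0 : (0 < p)%R. Proof. exact: lt_le_trans p1. Qed.

Lemma le_poweR (x y : \bar R) (r : R) :
  (0 <= r)%R -> 0 <= x -> x <= y -> x `^ r <= y `^ r.
Proof.
move=> r0 x0 xy; apply: gt0_ler_poweR => //; rewrite in_itv/= ?x0 ?leey//.
by rewrite (le_trans x0 xy).
Qed.

Lemma measurable_fun_poweR D f (r : R) :
  measurable_fun D f -> measurable_fun D (fun x => f x `^ r).
Proof. exact: (measurableT_comp (measurable_poweR r)). Qed.

Lemma pnorm_ge0 D f : 0 <= pnorm D f. Proof. exact: poweR_ge0. Qed.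

Lemma pnorm_le D f g : measurable D ->
  measurable_fun D f -> measurable_fun D g ->
  (forall x, D x -> 0 <= f x) -> (forall x, D x -> f x <= g x) ->
  pnorm D f <= pnorm D g.
Proof.
move=> mD mf mg f0 fg; apply: le_poweR.
- by rewrite invr_ge0 ltW.
- by apply: integral_ge0 => x _; exact: poweR_ge0.
- apply: ge0_le_integral => //; try exact: measurable_fun_poweR.
  + by move=> x _; exact: poweR_ge0.
  + by move=> x Dx; apply: le_poweR; rewrite ?fg ?f0// ltW.
Qed.

Lemma pnorm_subset D A f : measurable D -> measurable A -> A `<=` D ->
  measurable_fun D f -> pnorm A f <= pnorm D f.
Proof.
move=> mD mA AD mf; apply: le_poweR.
- by rewrite invr_ge0 ltW.
- by apply: integral_ge0 => x _; exact: poweR_ge0.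
- apply: ge0_subset_integral => //; first exact: measurable_fun_poweR.
  by move=> x _; exact: poweR_ge0.
Qed.

Lemma eq_pnorm D f g : {in D, f =1 g} -> pnorm D f = pnorm D g.
Proof. by move=> fg; congr (_ `^ _); apply: eq_integral => x xD; rewrite fg. Qed.

Lemma poweR_restrict A f : (fun x => (f \_ A) x `^ p) = (fun x => f x `^ p) \_ A.
Proof.
apply/funext => x; rewrite !patchE; case: ifPn => // _.
by rewrite poweR0r// gt_eqF.
Qed.

Lemma pnorm_restrict D A f : pnorm D (f \_ A) = pnorm (D `&` A) f.
Proof. by rewrite /pnorm poweR_restrict -integral_mkcondr. Qed.

Lemma pnorm_Lnorm D (f : T -> R) : (forall x, D x -> (0 <= f x)%R) ->
  pnorm D (EFin \o f) = Lnorm mu p%:E (EFin \o (f \_ D)).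
Proof.
move=> f0; rewrite /pnorm unlock integral_mkcond -poweR_restrict.
congr (_ `^ _); apply: eq_integral => x _; congr (_ `^ _).
rewrite !patchE/= patchE; case: ifPn => /=; last by rewrite normr0.
by rewrite inE => /f0 ?; rewrite ger0_norm.
Qed.

Lemma pnormD D f g h : measurable D ->
  measurable_fun D f -> measurable_fun D g -> measurable_fun D h ->
  (forall x, D x -> 0 <= f x) ->
  (forall x, D x -> 0 <= g x < +oo) -> (forall x, D x -> 0 <= h x < +oo) ->
  (forall x, D x -> f x <= g x + h x) ->
  pnorm D f <= pnorm D g + pnorm D h.
Proof.
move=> mD mf mg mh f0 g0 h0 fgh.
have fin k : (forall x, D x -> 0 <= k x < +oo) ->
    pnorm D k = pnorm D (EFin \o (fine \o k)).
  move=> k0; apply: eq_pnorm => x /[!inE] Dx /=.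
  by rewrite fineK// ge0_fin_numE; case/andP: (k0 _ Dx).
have fine0 k : (forall x, D x -> 0 <= k x < +oo) ->
    forall x, D x -> (0 <= fine (k x))%R.
  by move=> k0 x /k0/andP[k1 _]; exact: fine_ge0.
have mfine k : measurable_fun D k -> measurable_fun setT ((fine \o k) \_ D).
  move=> mk; apply/(measurable_restrictT _ mD).1.
  by apply: measurableT_comp => //; exact: measurable_fine.
apply: (@le_trans _ _ (pnorm D (EFin \o ((fine \o g) \+ (fine \o h))%R))).
  apply: pnorm_le => //.
    by apply/measurable_EFinP; apply: measurable_funD;
      apply: measurableT_comp => //; exact: measurable_fine.
  move=> x Dx /=; rewrite EFinD !fineK ?fgh// ge0_fin_numE.
  - by case/andP: (h0 _ Dx).
  - by case/andP: (h0 _ Dx).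
  - by case/andP: (g0 _ Dx).
  - by case/andP: (g0 _ Dx).
rewrite (fin g g0) (fin h h0) !pnorm_Lnorm.
- have -> : (((fine \o g) \+ (fine \o h)) \_ D =
      ((fine \o g) \_ D \+ (fine \o h) \_ D))%R.
    by apply/funext => x /=; rewrite !patchE; case: ifPn; rewrite ?addr0.
  by apply: minkowski_EFin => //; exact: mfine.
- exact: fine0.
- exact: fine0.
- by move=> x Dx /=; apply: addr_ge0; exact: fine0.
Qed.

Lemma pnorm_setU A B f : measurable A -> measurable B ->
  measurable_fun (A `|` B) f -> (forall x, (A `|` B) x -> 0 <= f x < +oo) ->
  pnorm (A `|` B) f <= pnorm A f + pnorm B f.
Proof.
move=> mA mB mf f0; have mAB := measurableU _ _ mA mB.
have mr C : measurable C -> measurable_fun (A `|` B) (f \_ C).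
  move=> mC; apply/measurable_restrict => //; apply: measurable_funS mf => //.
have r0 C x : (A `|` B) x -> 0 <= (f \_ C) x < +oo.
  by move=> /f0; rewrite patchE; case: ifPn => // _ _; rewrite lexx ltry.
apply: le_trans (pnormD mAB mf (mr A mA) (mr B mB) _ _ _ _) _ => //.
- by move=> x /f0/andP[].
- exact: r0.
- exact: r0.
- move=> x ABx; rewrite !patchE; case: ifPn => [_|].
    by rewrite leeDl//; case: ifPn => // _; case/andP: (f0 _ ABx).
  rewrite notin_setE; case: ABx => // Bx _.
  by rewrite (mem_set Bx) add0e.
- by rewrite !pnorm_restrict setUK setUC setUK.
Qed.

Lemma pnorm_cst D (c : R) : measurable D -> mu D <= 1 -> (0 <= c)%R ->
  pnorm D (cst c%:E) <= c%:E.
Proof.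
move=> mD D1 c0; rewrite /pnorm -[leRHS]poweRe1 ?lee_fin// -(mulfV (lt0r_neq0 p_gt0)).
rewrite poweRrM; apply: le_poweR.
- by rewrite invr_ge0 ltW.
- by apply: integral_ge0 => x _; exact: poweR_ge0.
- rewrite (_ : (fun _ => _) = cst (c%:E `^ p))// integral_cst//.
  rewrite -[leRHS]mule1; by apply: lee_wpmul2l; rewrite ?lee_fin ?powR_ge0.
Qed.

Lemma pnorm_bigcup_le (F : (set T)^nat) f (c : \bar R) :
  nondecreasing_seq F -> (forall n, measurable (F n)) ->
  measurable_fun (\bigcup_n F n) f ->
  (forall n, pnorm (F n) f <= c) -> pnorm (\bigcup_n F n) f <= c.
Proof.
move=> ndF mF mf Fc.
have c0 : 0 <= c by apply: le_trans (Fc 0%N); exact: pnorm_ge0.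
have pinv (x y : \bar R) : 0 <= x -> 0 <= y -> x `^ p^-1 <= y <-> x <= y `^ p.
  move=> x0 y0; split => [|] xy.
    have := le_poweR (ltW p_gt0) (poweR_ge0 _ _) xy.
    by rewrite -poweRrM mulVf ?poweRe1// gt_eqF.
  have := @le_poweR x (y `^ p) (p^-1); rewrite invr_ge0 => /(_ (ltW p_gt0) x0 xy).
  by rewrite -poweRrM mulfV ?poweRe1// gt_eqF.
have i0 D : 0 <= \int[mu]_(x in D) f x `^ p.
  by apply: integral_ge0 => x _; exact: poweR_ge0.
have cvg := @ge0_nondecreasing_set_cvg_integral _ _ _ F (fun x => f x `^ p) mu ndF mF.
rewrite /pnorm pinv//; rewrite -(cvg_lim _ (cvg _ _))//.
- apply: lime_le.
  + by apply/cvg_ex; eexists; apply: cvg => [i|*]; [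
      apply: measurable_fun_poweR; apply: measurable_funS mf => //;
      [exact: bigcupT_measurable|exact: bigcup_sup]|exact: poweR_ge0].
  + by apply: nearW => n; apply/pinv => //; exact: Fc.
- move=> n; apply: measurable_fun_poweR; apply: measurable_funS mf.
    exact: bigcupT_measurable.
  exact: bigcup_sup.
- by move=> *; exact: poweR_ge0.
Qed.

End PowerNorm.

(** * Lebesgue measure on intervals *)

Section LebesguePowerNorm.
Context (R : realType) (p : R).
Hypothesis p1 : 1 <= p.
Implicit Types (f g : R -> \bar R) (a b h s : R).
Local Open Scope ereal_scope.
Local Notation mu := (@lebesgue_measure R).

(* The superlevel set [f > c] is the union over rationals [q] of the intervals
   of those [x > q] such that [f > c] on [(q, x]]. *)
Lemma left_lsc_measurable_fun a b f :
  (forall x c, (a < x <= b)%R -> c < f x ->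
     exists2 y, (a <= y < x)%R & forall z, (y < z <= x)%R -> c < f z) ->
  measurable_fun `]a, b] f.
Proof.
move=> lscf mD; apply: (measurability _ (ErealGenOInfty.measurableE R)).
move=> /= _ [_ [c ->]] <-; rewrite preimage_itvoy.
rewrite [X in measurable X](_ : _ = \bigcup_(q : rat)
  [set x | [/\ (a < x <= b)%R, (ratr q < x)%R
             & forall z, (ratr q < z <= x)%R -> c%:E < f z]]).
  apply: bigcupT_measurable_rat => q; apply: is_interval_measurable.
  move=> x y [/andP[ax _] qx _] [/andP[_ yb] _ qy] z /andP[xz zy]; split.
  - by rewrite (lt_le_trans ax xz) (le_trans zy yb).
  - exact: lt_le_trans xz.
  - by move=> t /andP[qt tz]; rewrite qy// qt (le_trans tz zy).
rewrite eqEsubset; split => x /=.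
  rewrite in_itv/= => -[axb cfx]; have [y /andP[ay yx] yf] := lscf _ _ axb cfx.
  have [q /[!in_itv]/=/andP[yq qx]] := rat_in_itvoo yx.
  exists q => //; split => // z /andP[qz zx]; apply: yf.
  by rewrite zx (lt_trans yq).
  move=> [q _ [axb qx qf]]; rewrite in_itv/=; split => //.
  by apply: qf; rewrite qx lexx.
exact: mD.
Qed.

Lemma pnorm_shift a b h f : measurable_fun `]a, b] f ->
  (forall x, (a < x <= b)%R -> 0 <= f x) ->
  pnorm mu p `](a + h)%R, (b + h)%R] (fun x => f (x - h)%R) = pnorm mu p `]a, b] f.
Proof.
move=> mf f0; congr (_ `^ _).
pose phi (x : measurableTypeR R) : measurableTypeR R := (x - h)%R.
have mphi : measurable_fun setT phi by exact: measurable_funB.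
have phiE u v : phi @^-1` `]u, v] = `](u + h)%R, (v + h)%R]%classic.
  apply/seteqP; split => x /=; rewrite !in_itv/= /phi => ?; apply/andP; lra.
rewrite -phiE.
transitivity (\int[pushforward mu phi]_(x in `]a, b]) f x `^ p).
  rewrite (ge0_integral_pushforward mphi)//.
  - exact: measurable_fun_poweR.
  - by move=> x _; exact: poweR_ge0.
apply: eq_measure_integral => A mA _; apply/esym.
apply: (lebesgue_measure_unique (mu := pushforward mu phi)) => // _ [[u v] _ <-].
rewrite /pushforward [X in _ = mu X](phiE u v) !lebesgue_measure_itv/= !lte_fin.
by rewrite ltrD2r -!EFinD opprD addrACA subrr addr0.
Qed.

Lemma pnorm_itv_le a b s f (c : \bar R) : (0 < s)%R ->
  measurable_fun `]a, b] f ->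
  (forall t, (0 < t < s)%R -> pnorm mu p `](a + t)%R, (b - t)%R] f <= c) ->
  pnorm mu p `]a, b] f <= c.
Proof.
move=> s0 mf fc; pose F n := `](a + s / n.+2%:R)%R, (b - s / n.+2%:R)%R]%classic.
have UF : \bigcup_n F n = `]a, b[%classic.
  apply/seteqP; split => x /=.
    move=> [n _]; rewrite /F/= !in_itv/=.
    have : (0 < s / n.+2%:R)%R by rewrite divr_gt0.
    by move: (s / _)%R => t ? ?; apply/andP; lra.
  rewrite in_itv/= => /andP[ax xb].
  pose e : R := Num.min (x - a)%R (b - x)%R.
  have e0 : (0 < e)%R by rewrite lt_min !subr_gt0 ax xb.
  have [n ne] : exists n, (s / n.+2%:R < e)%R.
    have /archi_boundP : (0 <= s / e)%R by rewrite divr_ge0 ?ltW.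
    set k := Num.bound _ => sk; exists k.
    rewrite ltr_pdivrMr// -ltr_pdivrMl// mulrC (lt_le_trans sk)// ler_nat.
    by rewrite -addn2 leq_addr.
  exists n => //; rewrite /F/= in_itv/=; move: ne; rewrite lt_min.
  by move: (s / _)%R => t ?; apply/andP; lra.
have mfo : measurable_fun `]a, b[ f.
  by apply: measurable_funS mf => //; apply: subset_itvW.
have -> : pnorm mu p `]a, b] f = pnorm mu p `]a, b[ f.
  by congr (_ `^ _); apply/esym/integral_itv_bndo_bndc; exact: measurable_fun_poweR.
rewrite -UF; apply: (pnorm_bigcup_le p1).
- apply/nondecreasing_seqP => n; rewrite subsetEset => x /=.
  rewrite /F/= !in_itv/=.
  have : (s / n.+3%:R <= s / n.+2%:R)%R by rewrite ler_pM2l// lef_pV2 ?posrE// ler_nat.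
  by move: (s / _)%R (s / _)%R => t u ? ?; apply/andP; lra.
- by move=> n; exact: measurable_itv.
- by rewrite UF.
- move=> n; apply: fc; rewrite divr_gt0//= ltr_pdivrMr// ltr_pMr// ltr1n.
  by [].
Qed.

Lemma pnorm_itvcc a b f : measurable_fun `]a, b] f ->
  pnorm mu p `[a, b] f = pnorm mu p `]a, b] f.
Proof.
move=> mf; congr (_ `^ _); apply/esym/integral_itv_obnd_cbnd.
exact: measurable_fun_poweR.
Qed.

Lemma pnorm_itv_cst a b (c : R) : (b - a <= 1)%R -> (0 <= c)%R ->
  pnorm mu p `]a, b] (cst c%:E) <= c%:E.
Proof.
move=> ab c0; by apply: pnorm_cst => //=; rewrite lebesgue_measure_itv/=; case: ifPn => // _.
Qed.

End LebesguePowerNorm.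

(** * Euclidean distance *)

Section EuclideanDistance.
Context (R : realType) (m : nat).
Implicit Types (x y z : 'rV[R]_m) (e r : R).

Lemma euclid_dist_ge0 x y : 0 <= euclid_dist x y.
Proof. exact: sqrtr_ge0. Qed.

Lemma euclid_distxx x : euclid_dist x x = 0.
Proof.
by rewrite /euclid_dist big1 ?sqrtr0// => i _; rewrite subrr expr0n.
Qed.

Lemma euclid_distC x y : euclid_dist x y = euclid_dist y x.
Proof.
rewrite /euclid_dist; congr Num.sqrt; apply: eq_bigr => i _.
by rewrite -sqrrN opprB.
Qed.

Lemma sqrt_sum_sqrD (a b : 'I_m -> R) :
  Num.sqrt (\sum_i (a i + b i) ^+ 2) <=
  Num.sqrt (\sum_i a i ^+ 2) + Num.sqrt (\sum_i b i ^+ 2).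
Proof.
set A := \sum_i a i ^+ 2; set B := \sum_i b i ^+ 2.
have A0 : 0 <= A by apply: sumr_ge0 => i _; exact: sqr_ge0.
have B0 : 0 <= B by apply: sumr_ge0 => i _; exact: sqr_ge0.
have CS : \sum_i a i * b i <= Num.sqrt A * Num.sqrt B.
  have [AB0|AB0] := eqVneq (Num.sqrt A * Num.sqrt B) 0.
    rewrite AB0 big1// => i _; move/eqP: AB0.
    have zero (c : 'I_m -> R) : Num.sqrt (\sum_i c i ^+ 2) == 0 -> c i = 0.
      have c0 j : true -> 0 <= c j ^+ 2 by move=> _; exact: sqr_ge0.
      rewrite sqrtr_eq0 => cle; have /eqP : \sum_i c i ^+ 2 = 0.
        by apply/eqP; rewrite eq_le cle sumr_ge0.
      by rewrite psumr_eq0// => /allP/(_ i (mem_index_enum i))/=; rewrite sqrf_eq0 => /eqP.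
    by rewrite mulf_eq0 => /orP[]/zero ->; rewrite ?mul0r ?mulr0.
  have AB : 0 < Num.sqrt A * Num.sqrt B by rewrite lt0r AB0 mulr_ge0 ?sqrtr_ge0.
  have : 0 <= \sum_i (Num.sqrt B * a i - Num.sqrt A * b i) ^+ 2.
    by apply: sumr_ge0 => i _; exact: sqr_ge0.
  have -> : \sum_i (Num.sqrt B * a i - Num.sqrt A * b i) ^+ 2 =
     Num.sqrt B ^+ 2 * A + Num.sqrt A ^+ 2 * B
     - 2 * (Num.sqrt A * Num.sqrt B) * \sum_i a i * b i.
    rewrite !mulr_sumr -big_split/= -sumrB; apply: eq_bigr => i _; ring.
  rewrite !sqr_sqrtr// => h.
  rewrite -(ler_pM2l AB); rewrite -subr_ge0.
  rewrite -[X in _ <= X - _]expr2 exprMn !sqr_sqrtr//; lra.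
rewrite -(ler_pXn2r (n := 2))// ?nnegrE ?addr_ge0 ?sqrtr_ge0//.
rewrite sqr_sqrtr; last by apply: sumr_ge0 => i _; exact: sqr_ge0.
have -> : \sum_i (a i + b i) ^+ 2 = A + B + 2 * \sum_i a i * b i.
  rewrite !mulr_sumr -!big_split/=; apply: eq_bigr => i _; ring.
rewrite sqrrD !sqr_sqrtr//; lra.
Qed.

Lemma euclid_dist_triangle y x z :
  euclid_dist x z <= euclid_dist x y + euclid_dist y z.
Proof.
apply: le_trans (sqrt_sum_sqrD _ _); apply: ler_wsqrtr.
by rewrite le_eqVlt; apply/orP; left; apply/eqP; apply: eq_bigr => i _; rewrite addrA subrK.
Qed.

Lemma norm_le_euclid_dist x y : `|x - y| <= euclid_dist x y.
Proof.
rewrite {1}/Num.norm/= mx_normrE; apply/bigmax_leP; split=> [|[i j] _ /=].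
  exact: euclid_dist_ge0.
rewrite ord1 !mxE -sqrtr_sqr; apply: ler_wsqrtr.
by rewrite (bigD1 j)//= lerDl sumr_ge0// => k _; exact: sqr_ge0.
Qed.

Lemma euclid_dist_le_norm x y : euclid_dist x y <= m%:R * `|x - y|.
Proof.
have nx i : `|x ord0 i - y ord0 i| <= `|x - y|.
  rewrite [leRHS]/Num.norm/= mx_normrE; apply/bigmax_geP; right.
  by exists (ord0, i) => //=; rewrite !mxE.
rewrite -(ler_pXn2r (n := 2))// ?nnegrE ?mulr_ge0 ?euclid_dist_ge0//.
rewrite sqr_sqrtr; last by apply: sumr_ge0 => i _; exact: sqr_ge0.
apply: (@le_trans _ _ (\sum_(i < m) `|x - y| ^+ 2)).
  apply: ler_sum => i _; rewrite -(real_normK (num_real _)).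
  by rewrite ler_pXn2r ?nnegrE.
rewrite sumr_const card_ord exprMn -[X in X <= _]mulr_natl ler_wpM2r ?sqr_ge0//.
by rewrite expr2 -natrM ler_nat; case: m => // k; rewrite leq_pmull.
Qed.

Lemma nbhs_euclid x e : 0 < e -> \forall y \near x, euclid_dist x y < e.
Proof.
move=> e0; apply/nbhs_ballP; exists (e / m.+1%:R); first by rewrite /= divr_gt0.
move=> y; rewrite -ball_normE /= => xy.
rewrite (le_lt_trans (euclid_dist_le_norm _ _))//.
apply: (@le_lt_trans _ _ (m.+1%:R * `|x - y|)).
  by rewrite ler_wpM2r// ler_nat.
by rewrite mulrC -ltr_pdivlMr.
Qed.

Lemma nbhs_euclidP x (P : set 'rV[R]_m) : nbhs x P ->
  exists2 e, 0 < e & forall y, euclid_dist x y < e -> P y.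
Proof.
move=> /nbhs_ballP[e e0 eP]; exists e => // y xy; apply: eP.
by rewrite -ball_normE/=; exact: le_lt_trans (norm_le_euclid_dist _ _) xy.
Qed.

Lemma closed_euclidP (A : set 'rV[R]_m) :
  closed A <-> forall x, (forall e, 0 < e -> exists2 y, A y & euclid_dist x y < e) -> A x.
Proof.
split=> [cA x xA|h x xA]; last first.
  by apply: h => e /(nbhs_euclid x)/xA[y [Ay xy]]; exists y.
by apply: cA => B /nbhs_euclidP[e /xA[y Ay xy] eB]; exists y; split => //; exact: eB.
Qed.

Lemma ultra_bounded_limit (T : Type) (F : set_system T) (g : T -> 'rV[R]_m) r :
  UltraFilter F -> F [set t | euclid_dist (g t) 0 <= r] ->
  exists x, forall e, 0 < e -> F [set t | euclid_dist (g t) x < e].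
Proof.
move=> FU Fr; pose K := [set x : 'rV[R]_m | euclid_dist x 0 <= r].
have cK : compact K.
  apply: bounded_closed_compact.
    exists r; split; first exact: num_real.
    move=> s rs x Kx /=; apply: le_trans (ltW rs); apply: le_trans Kx.
    by rewrite -[x in leLHS]subr0 norm_le_euclid_dist.
  apply/closed_euclidP => x xK; rewrite /K/=; apply/ler_addgt0Pr => e /xK[y Ky xy].
  by have := euclid_dist_triangle y x 0; move: Ky; rewrite /K/=; lra.
have [x [_ Fx]] : K `&` cluster (g @ F) !=set0 by exact: cK.
exists x => e e0.
have [//|FC] := in_ultra_setVsetC [set t | euclid_dist (g t) x < e] FU.
have [y []] := Fx (~` [set y | euclid_dist y x < e]) _ FC (nbhs_euclid x e0).
by rewrite /= euclid_distC.
Qed.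

End EuclideanDistance.

(** * One-sided Hausdorff distance and level cuts *)

Section Excess.
Context (R : realType) (m : nat).
Implicit Types (A B C : set 'rV[R]_m) (x y : 'rV[R]_m) (c e r : R).
Local Open Scope ereal_scope.

Definition excess A B : \bar R :=
  ereal_sup [set ereal_inf [set (euclid_dist a b)%:E | b in B] | a in A].

Lemma hausdorffE A B : hausdorff A B = maxe (excess A B) (excess B A).
Proof.
rewrite /hausdorff; congr (maxe _ _); congr ereal_sup.
by apply: eq_imagel => b _; congr ereal_inf; apply: eq_imagel => a _; rewrite euclid_distC.
Qed.

Lemma excess_leP A B c : excess A B <= c%:E <->
  forall a, A a -> forall e, (0 < e)%R ->
    exists2 b, B b & (euclid_dist a b < c + e)%R.
Proof.
split=> [AB a Aa e e0|AB].
  have : ereal_inf [set (euclid_dist a b)%:E | b in B] < (c + e)%:E.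
    apply: (@le_lt_trans _ _ c%:E); last by rewrite lte_fin ltrDl.
    by apply: le_trans AB; apply: ereal_sup_ubound; exists a.
  by move=> /ereal_inf_lt[_ [b Bb <-]]; rewrite lte_fin => ab; exists b.
apply: ge_ereal_sup => _ [a Aa <-]; apply/lee_addgt0Pr => e /(AB a Aa)[b Bb ab].
apply: (@le_trans _ _ (euclid_dist a b)%:E); last by rewrite -EFinD lee_fin ltW.
by apply: ereal_inf_lbound; exists b.
Qed.

Lemma excess_le A B c :
  (forall a, A a -> exists2 b, B b & (euclid_dist a b <= c)%R) ->
  excess A B <= c%:E.
Proof.
move=> AB; apply/excess_leP => a /AB[b Bb ab] e e0; exists b => //.
by rewrite (le_lt_trans ab)// ltrDl.
Qed.

Lemma excess_lt A B c a : excess A B < c%:E -> A a ->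
  exists2 b, B b & (euclid_dist a b < c)%R.
Proof.
move=> ABc Aa.
have : ereal_inf [set (euclid_dist a b)%:E | b in B] < c%:E.
  by apply: le_lt_trans ABc; apply: ereal_sup_ubound; exists a.
by move=> /ereal_inf_lt[_ [b Bb <-]]; rewrite lte_fin => ab; exists b.
Qed.

Lemma excess_ge0 A B : A !=set0 -> 0 <= excess A B.
Proof.
move=> [a Aa]; apply: le_ereal_sup_tmp.
exists (ereal_inf [set (euclid_dist a b)%:E | b in B]); first by exists a.
by apply: le_ereal_inf_tmp => _ [b _ <-]; rewrite lee_fin euclid_dist_ge0.
Qed.

Lemma excess_subset0 A B : A `<=` B -> excess A B <= 0.
Proof.
move=> AB; apply: (@excess_le A B 0) => a /AB Ba; exists a => //.
by rewrite euclid_distxx.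
Qed.

Lemma excess_mono A A' B B' : A `<=` A' -> B' `<=` B -> excess A B <= excess A' B'.
Proof.
move=> AA' B'B; apply: ge_ereal_sup => _ [a Aa <-]; apply: le_ereal_sup_tmp.
exists (ereal_inf [set (euclid_dist a b)%:E | b in B']); first by exists a => //; exact: AA'.
by apply: le_ereal_inf => _ [b B'b <-]; exists b => //; exact: B'B.
Qed.

Lemma excess_triangle A B C : A !=set0 -> B !=set0 ->
  excess A C <= excess A B + excess B C.
Proof.
move=> A0 B0; have := excess_ge0 B A0; have := excess_ge0 C B0.
case EBC : (excess B C) => [s| |//] => [s0|_]; last first.
  by move=> h; rewrite addey ?leey// -ltNye (lt_le_trans _ h).
case EAB : (excess A B) => [r| |//] => [r0|_]; last by rewrite addye ?leey.
rewrite -EFinD; apply/excess_leP => a Aa e e0.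
have /excess_leP/(_ a Aa (e / 2)%R) : excess A B <= r%:E by rewrite EAB.
rewrite divr_gt0// => /(_ isT)[b Bb ab].
have /excess_leP/(_ b Bb (e / 2)%R) : excess B C <= s%:E by rewrite EBC.
rewrite divr_gt0// => /(_ isT)[c Cc bc].
by exists c => //; have := euclid_dist_triangle b a c; lra.
Qed.

Lemma excess_le_hausdorff A B : excess A B <= hausdorff A B.
Proof. by rewrite hausdorffE le_max lexx. Qed.

Lemma hausdorffC A B : hausdorff A B = hausdorff B A.
Proof. by rewrite !hausdorffE maxC. Qed.

Lemma hausdorff_le A B (c : \bar R) :
  excess A B <= c -> excess B A <= c -> hausdorff A B <= c.
Proof. by rewrite hausdorffE ge_max => -> ->. Qed.

Lemma hausdorff_ge0 A B : A !=set0 -> 0 <= hausdorff A B.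
Proof. by move=> A0; apply: le_trans (excess_le_hausdorff _ _); exact: excess_ge0. Qed.

Lemma hausdorff_triangle A B C : A !=set0 -> B !=set0 -> C !=set0 ->
  hausdorff A C <= hausdorff A B + hausdorff B C.
Proof.
move=> A0 B0 C0; apply: hausdorff_le.
  apply: le_trans (excess_triangle C A0 B0) _.
  by apply: leeD; exact: excess_le_hausdorff.
apply: le_trans (excess_triangle A C0 B0) _; rewrite addeC.
by apply: leeD; rewrite hausdorffC; exact: excess_le_hausdorff.
Qed.

Lemma excess_lty A B : euclid_bounded A -> B !=set0 -> excess A B < +oo.
Proof.
move=> [M AM] [b Bb]; apply: (@le_lt_trans _ _ (M + euclid_dist 0%R b)%:E); last exact: ltry.
apply: excess_le => a /AM aM; exists b => //.
by have := euclid_dist_triangle 0%R a b; lra.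
Qed.

Lemma hausdorff_lty A B : euclid_bounded A -> A !=set0 ->
  euclid_bounded B -> B !=set0 -> hausdorff A B < +oo.
Proof. by move=> bA A0 bB B0; rewrite hausdorffE gt_max !excess_lty. Qed.

Lemma hausdorff_set1 A x : A !=set0 -> hausdorff A [set x] = excess A [set x].
Proof.
move=> A0; rewrite hausdorffE; apply/max_idPl.
have [a Aa] := A0; have := excess_ge0 [set x] A0.
case E : (excess A [set x]) => [r| |//] => [r0|_]; last exact: leey.
apply/excess_leP => _ -> e e0; exists a => //; rewrite euclid_distC.
by have /excess_leP/(_ a Aa e e0)[_ ->] : excess A [set x] <= r%:E by rewrite E.
Qed.

End Excess.

Section LevelCut.
Context (R : realType) (m : nat).
Implicit Types (u v w : 'rV[R]_m -> R) (a b c : R).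

(* A common superset of [FB] and [FBp], on which [dp] is well behaved but
   possibly infinite. *)
Definition fuzzy_compact u : Prop :=
  [/\ fuzzy_set u, normal_fuzzy u, upper_semicontinuous u
    & forall a, 0 < a -> euclid_bounded (level_cut u a)].

Lemma level_cutE u a : 0 < a -> level_cut u a = [set x | a <= u x].
Proof. by move=> a0; rewrite /level_cut gt_eqF. Qed.

Lemma level_cut_subset u a b : 0 <= a <= b -> level_cut u b `<=` level_cut u a.
Proof.
rewrite /level_cut => /andP[a0 ab].
have [b0|bN0] := eqVneq b 0; first by have -> : a == 0 by rewrite eq_le a0 -b0 ab.
have [aE|aN0] := eqVneq a 0 => x /= bx; last exact: le_trans bx.
by apply: subset_closure; rewrite /= (lt_le_trans _ bx)// lt0r bN0 (le_trans a0).
Qed.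

Lemma level_cut_nonempty u a : normal_fuzzy u -> 0 <= a <= 1 -> level_cut u a !=set0.
Proof.
move=> [x ux] a1; exists x; apply: (level_cut_subset a1).
by rewrite level_cutE//= ux.
Qed.

Lemma level_cut_closed u a : upper_semicontinuous u -> 0 < a -> closed (level_cut u a).
Proof.
move=> uscu a0; rewrite level_cutE// => x xcl; apply: contrapT => /negP.
by rewrite -ltNge => /uscu/xcl[y [/= ay]]; rewrite ltNge ay.
Qed.

Lemma FB_fuzzy_compact u : FB R m u -> fuzzy_compact u.
Proof.
move=> [fu nu uu [M bu]]; split => // a a0; exists M => x xa; apply: bu.
by apply: level_cut_subset xa; rewrite lexx ltW.
Qed.

Lemma fuzzy_zeroE (x : 'rV[R]_m) : @fuzzy_zero R m x = (x == 0)%:R.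
Proof.
rewrite /fuzzy_zero indicE; congr (_%:R); congr nat_of_bool.
by apply/idP/eqP => [/set_mem//|->]; rewrite inE.
Qed.

Lemma level_cut_fuzzy_zero a : 0 < a <= 1 -> level_cut (@fuzzy_zero R m) a = [set 0].
Proof.
move=> /andP[a0 a1]; rewrite level_cutE//; apply/seteqP; split => x /=.
  by rewrite fuzzy_zeroE; case: eqP => //= _; rewrite leNgt a0.
by move=> ->; rewrite fuzzy_zeroE eqxx.
Qed.

Lemma fuzzy_zero_FB : FB R m (@fuzzy_zero R m).
Proof.
split.
- by move=> x; rewrite fuzzy_zeroE; case: (_ == _); rewrite ?lexx ler01.
- by exists 0; rewrite fuzzy_zeroE eqxx.
- move=> x a; rewrite fuzzy_zeroE; have [->|x0] := eqVneq x 0 => xa.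
    by apply: filterS (nbhs_euclid 0 ltr01) => y _; rewrite fuzzy_zeroE (le_lt_trans _ xa)// ler_nat leq_b1.
  have d0 : 0 < euclid_dist x 0.
    apply: lt_le_trans (norm_le_euclid_dist _ _).
    by rewrite subr0 normr_gt0.
  apply: filterS (nbhs_euclid x d0) => y xy; rewrite fuzzy_zeroE.
  by case: eqVneq xy => [->|//]; rewrite ltxx.
- exists 0 => x; rewrite /level_cut eqxx => xcl; apply/ler_addgt0Pr => e e0.
  have [y [/=]] := xcl _ (nbhs_euclid x e0); rewrite fuzzy_zeroE.
  by case: eqP => [-> _ /ltW|]; rewrite ?add0r ?ltxx.
Qed.

Lemma level_cut_left u a e : fuzzy_compact u -> 0 < a -> 0 < e ->
  exists2 b, 0 < b < a & (excess (level_cut u b) (level_cut u a) <= e%:E)%E.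
Proof.
move=> [_ _ uu bu] a0 e0; apply: contrapT => noB.
have far b : exists x, 0 < b < a ->
    level_cut u b x /\ forall y, level_cut u a y -> e <= euclid_dist x y.
  have [ba|] := boolP (0 < b < a); last by exists 0.
  apply: contrapT => nofar; apply: noB; exists b => //.
  apply: excess_le => x bx; apply: contrapT => noy; apply: nofar.
  exists x => _; split => // y ay; rewrite leNgt; apply/negP => xy.
  by apply: noy; exists y => //; exact: ltW.
have [g gP] := choice far.
have [G [GU leftG]] := ultraFilterLemma (at_left_proper_filter a).
have Gleft c : c < a -> G [set b | c < b < a].
  by move=> ca; apply: leftG; near=> b => /=; apply/andP; split; near: b;
    [exact: nbhs_left_gt|exact: nbhs_left_lt].
have [M uM] := bu (a / 2) (divr_gt0 a0 (ltr0Sn R 1)).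
have [|x xlim] := @ultra_bounded_limit _ _ _ G g M GU.
  have : G [set b | a / 2 < b < a] by apply: Gleft; lra.
  apply: filterS => b /= ba; have [|gb _] := gP b; first by lra.
  by apply: uM; apply: level_cut_subset gb; lra.
have ax : level_cut u a x.
  rewrite level_cutE//= leNgt; apply/negP => xa.
  pose c := (Num.max (u x) 0 + a) / 2.
  have ma : Num.max (u x) 0 < a by rewrite gt_max xa a0.
  have [mx m0] : u x <= Num.max (u x) 0 /\ 0 <= Num.max (u x) 0.
    by rewrite !le_max !lexx orbT.
  have c0 : 0 < c by rewrite /c; lra.
  have : level_cut u c x.
    apply: (closed_euclidP _).1; first exact: level_cut_closed.
    move=> d /xlim Gd; have ca : c < a by rewrite /c; lra.
    have [b [/= bd bc]] := filter_ex (filterI Gd (Gleft c ca)).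
    exists (g b); last by rewrite euclid_distC.
    by have [|gb _] := gP b; [lra|apply: level_cut_subset gb; lra].
  by rewrite level_cutE//= /c; lra.
have [b [/= bd ba]] := filter_ex (filterI (xlim e e0) (Gleft 0 a0)).
by have [//|_ /(_ x ax)] := gP b; rewrite leNgt bd.
Unshelve. all: by end_near. Qed.

Lemma excess_cut_left u v a b (c : \bar R) : normal_fuzzy u -> fuzzy_compact v ->
  0 <= a <= 1 -> 0 < b <= 1 ->
  (c < excess (level_cut u a) (level_cut v b))%E ->
  exists2 b', 0 < b' < b &
    forall s t, 0 <= s <= a -> b' <= t ->
    (c < excess (level_cut u s) (level_cut v t))%E.
Proof.
move=> nu fcv a01 b01 cab; have [_ nv _ _] := fcv.
have [b' b'b cb'] : exists2 b', 0 < b' < b &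
    (c < excess (level_cut u a) (level_cut v b'))%E.
  apply: contrapT => nob; move: cab; rewrite ltNge => /negP; apply.
  apply/lee_addgt0Pr => e e0; have [|b' b'b bb'] := level_cut_left fcv _ e0 (a := b).
    by case/andP: b01.
  have ua := level_cut_nonempty nu a01.
  have vb' : level_cut v b' !=set0 by apply: level_cut_nonempty => //; lra.
  apply: le_trans (excess_triangle _ ua vb') _; apply: leeD => //.
  by rewrite leNgt; apply/negP => cb'; apply: nob; exists b'.
exists b' => // s t sa b't; apply: lt_le_trans cb' _.
by apply: excess_mono; apply: level_cut_subset => //; lra.
Qed.

(* Shifting the levels inside the definition makes [dp] and the left modulus two
   instances of one function, and lets translations act on it. *)
Definition cut_dist u v h k a : \bar R :=
  hausdorff (level_cut u (a - h)) (level_cut v (a - k)).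

Lemma measurable_cut_dist u v h k a b : fuzzy_compact u -> fuzzy_compact v ->
  0 <= a - h -> 0 <= a - k -> b - h <= 1 -> b - k <= 1 ->
  measurable_fun `]a, b] (cut_dist u v h k).
Proof.
move=> fcu fcv ah ak bh bk; have [_ nu _ _] := fcu; have [_ nv _ _] := fcv.
apply: left_lsc_measurable_fun => x c xab.
rewrite /cut_dist hausdorffE lt_max => /orP[] cx.
  have [||y yx cy] := excess_cut_left nu fcv _ _ cx; [lra|lra|].
  exists (Num.max a (y + k)); first by rewrite le_max lexx gt_max; lra.
  move=> z; rewrite gt_max => zx; rewrite hausdorffE lt_max cy//; lra.
have [||y yx cy] := excess_cut_left nv fcu _ _ cx; [lra|lra|].
exists (Num.max a (y + h)); first by rewrite le_max lexx gt_max; lra.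
move=> z; rewrite gt_max => zx; rewrite hausdorffE lt_max [X in _ || X]cy ?orbT//; lra.
Qed.

End LevelCut.

(** * The metric dp *)

Section FuzzyMetric.
Context (R : realType) (m : nat) (p : R).
Hypothesis p1 : 1 <= p.
Implicit Types (u v w : 'rV[R]_m -> R) (a b c h k s : R).
Local Open Scope ereal_scope.
Local Notation N a b := (pnorm (@lebesgue_measure R) p `]a%R, b%R]).

Let p_gt0 : (0 < p)%R. Proof. exact: lt_le_trans p1. Qed.

Lemma pnorm_itv_cstE a b c : (a <= b)%R -> (0 <= c)%R ->
  N a b (cst c%:E) = (c * (b - a) `^ p^-1)%:E.
Proof.
move=> ab c0; rewrite /pnorm.
rewrite (_ : (fun _ => _) = cst (c%:E `^ p))// integral_cst//=.
rewrite lebesgue_measure_itv/= lte_fin.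
have -> : (if (a < b)%R then b%:E - a%:E else 0) = (b - a)%:E.
  by case: ltP => // ba; congr EFin; apply/eqP; rewrite eq_sym subr_eq0 eq_le ab ba.
rewrite -EFinM poweR_EFin powRM ?powR_ge0 ?subr_ge0//.
by rewrite -powRrM mulfV ?powRr1// gt_eqF.
Qed.

Lemma le_pnorm_itv a b a' b' f : (a <= a')%R -> (b' <= b)%R ->
  measurable_fun `]a, b] f -> N a' b' f <= N a b f.
Proof.
move=> aa' bb' mf; apply: pnorm_subset => // x /=; rewrite !in_itv/= => ?.
by apply/andP; lra.
Qed.

Lemma cut_dist_ge0 u v h k a : normal_fuzzy u -> (0 <= a - h <= 1)%R ->
  0 <= cut_dist u v h k a.
Proof. by move=> nu ah; apply: hausdorff_ge0; exact: level_cut_nonempty. Qed.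

Lemma cut_dist_lty u v h k a : fuzzy_compact u -> fuzzy_compact v ->
  (0 < a - h <= 1)%R -> (0 < a - k <= 1)%R -> cut_dist u v h k a < +oo.
Proof.
move=> [_ nu _ bu] [_ nv _ bv] ah ak; apply: hausdorff_lty.
- by apply: bu; lra.
- by apply: level_cut_nonempty => //; lra.
- by apply: bv; lra.
- by apply: level_cut_nonempty => //; lra.
Qed.

Lemma cut_dist_fin u v h k a : fuzzy_compact u -> fuzzy_compact v ->
  (0 < a - h <= 1)%R -> (0 < a - k <= 1)%R -> 0 <= cut_dist u v h k a < +oo.
Proof.
move=> fcu fcv ah ak; rewrite cut_dist_lty// andbT; case: fcu => _ nu _ _.
by apply: cut_dist_ge0 => //; lra.
Qed.

Lemma pnorm_cut_dist_shift u v h k s a b : fuzzy_compact u -> fuzzy_compact v ->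
  (0 <= a - h)%R -> (0 <= a - k)%R -> (b - h <= 1)%R -> (b - k <= 1)%R ->
  N (a + s) (b + s) (cut_dist u v (h + s) (k + s)) = N a b (cut_dist u v h k).
Proof.
move=> fcu fcv ah ak bh bk; rewrite -(@pnorm_shift _ p a b s).
- by congr pnorm; apply/funext => x; rewrite /cut_dist; congr (hausdorff (level_cut _ _) (level_cut _ _)); lra.
- exact: measurable_cut_dist.
- by move=> x axb; apply: cut_dist_ge0; [case: fcu|lra].
Qed.

Lemma dpE u v : fuzzy_compact u -> fuzzy_compact v ->
  dp p u v = N 0 1 (cut_dist u v 0 0).
Proof.
move=> fcu fcv; rewrite -pnorm_itvcc; last by apply: measurable_cut_dist => //; lra.
by apply: eq_pnorm => a _; rewrite /cut_dist !subr0.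
Qed.

Lemma left_modulusE u h : fuzzy_compact u -> (0 <= h)%R ->
  (\int[lebesgue_measure]_(a in `[h, 1%R])
     hausdorff (level_cut u a) (level_cut u (a - h)%R) `^ p) `^ p^-1 =
  N h 1 (cut_dist u u 0 h).
Proof.
move=> fcu h0; rewrite -pnorm_itvcc; last by apply: measurable_cut_dist => //; lra.
by apply: eq_pnorm => a _; rewrite /cut_dist !subr0.
Qed.

Lemma dp_ge0 u v : 0 <= dp p u v. Proof. exact: poweR_ge0. Qed.

Lemma dpC u v : dp p u v = dp p v u.
Proof. by rewrite /dp; under eq_integral do rewrite hausdorffC. Qed.

Lemma pnorm_cut_dist_triangle u v w h k s a b :
  fuzzy_compact u -> fuzzy_compact v -> fuzzy_compact w ->
  (0 <= a - h)%R -> (0 <= a - k)%R -> (0 <= a - s)%R ->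
  (b - h <= 1)%R -> (b - k <= 1)%R -> (b - s <= 1)%R ->
  N a b (cut_dist u w h k) <= N a b (cut_dist u v h s) + N a b (cut_dist v w s k).
Proof.
move=> fcu fcv fcw ah ak as_ bh bk bs; have [_ nu _ _] := fcu.
have [_ nv _ _] := fcv; have [_ nw _ _] := fcw.
apply: pnormD => //; try exact: measurable_cut_dist.
- by move=> x /=; rewrite in_itv/= => ?; apply: cut_dist_ge0 => //; lra.
- by move=> x /=; rewrite in_itv/= => ?; apply: cut_dist_fin => //; lra.
- by move=> x /=; rewrite in_itv/= => ?; apply: cut_dist_fin => //; lra.
- move=> x /=; rewrite in_itv/= => ?; apply: hausdorff_triangle;
  by apply: level_cut_nonempty => //; lra.
Qed.

Lemma dp_triangle v u w : fuzzy_compact u -> fuzzy_compact v -> fuzzy_compact w ->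
  dp p u w <= dp p u v + dp p v w.
Proof.
by move=> fcu fcv fcw; rewrite !dpE//; apply: pnorm_cut_dist_triangle => //; lra.
Qed.

Lemma dpxx u : fuzzy_compact u -> dp p u u = 0.
Proof.
move=> fcu; apply/eqP; rewrite eq_le dp_ge0 andbT dpE//.
have := pnorm_itv_cst p1 (a := 0) (b := 1) (c := 0); rewrite subr0 => /(_ (lexx _) (lexx _)).
apply: le_trans; apply: pnorm_le => //.
- by apply: measurable_cut_dist => //; lra.
- by move=> x /=; rewrite in_itv/= => ?; apply: cut_dist_ge0; [case: fcu|lra].
- by move=> x _; rewrite /cut_dist; apply: hausdorff_le; exact: excess_subset0.
Qed.

Lemma dp_eq0 u v : fuzzy_compact u -> fuzzy_compact v -> dp p u v = 0 -> u = v.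
Proof.
suff le u' v' : fuzzy_compact u' -> fuzzy_compact v' -> dp p u' v' = 0 ->
    forall x, (u' x <= v' x)%R.
  move=> fcu fcv uv; apply/funext => x; apply/eqP; rewrite eq_le.
  have vu : dp p v u = 0 by rewrite dpC.
  by rewrite (le _ _ fcu fcv uv) (le _ _ fcv fcu vu).
move=> {u v}; move: u' v' => u v fcu fcv uv0 x; have [fu nu _ _] := fcu; have [fv nv uv _] := fcv.
rewrite leNgt; apply/negP => vu.
pose c := ((v x + u x) / 2)%R.
have [/andP[v0 _] /andP[_ u1]] := (fv x, fu x).
have [c0 cu vc] : [/\ (0 < c)%R, (c < u x)%R & (v x < c)%R] by rewrite /c; split; lra.
have [e e0 xe] : exists2 e, (0 < e)%R & forall y, level_cut v c y -> (e <= euclid_dist x y)%R.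
  apply: contrapT => noe; have : level_cut v c x.
    apply: (closed_euclidP _).1; first exact: level_cut_closed.
    move=> e e0; apply: contrapT => noy; apply: noe; exists e => // y cy.
    by rewrite leNgt; apply/negP => xy; apply: noy; exists y.
  by rewrite level_cutE//= leNgt vc.
have : N c (u x) (cst e%:E) <= 0.
  have mcd : measurable_fun (`]0%R, 1%R] : set R) (cut_dist u v 0 0).
    by apply: measurable_cut_dist => //; lra.
  rewrite -uv0 dpE//; apply: (@le_trans _ _ (N c (u x) (cut_dist u v 0 0))); last first.
    by apply: le_pnorm_itv => //; exact: ltW.
  apply: pnorm_le => //.
  - by apply: measurable_cut_dist => //; lra.
  - by move=> ? _; rewrite lee_fin ltW.
  - move=> a /=; rewrite in_itv/= => /andP[ca au].
    rewrite /cut_dist !subr0; apply: le_trans (excess_le_hausdorff _ _).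
    rewrite leNgt; apply/negP => uv_lt.
    have [|y ay] := excess_lt uv_lt (a := x).
      by rewrite level_cutE//= (lt_trans c0).
    by rewrite ltNge xe//; apply: level_cut_subset ay; rewrite !ltW.
rewrite pnorm_itv_cstE ?(ltW cu) ?(ltW e0)// lee_fin leNgt mulr_gt0//.
by rewrite powR_gt0// subr_gt0.
Qed.

Lemma measurable_hausdorff_set1 u (x : 'rV[R]_m) : normal_fuzzy u ->
  measurable_fun (`]0%R, 1%R] : set R) (fun a => hausdorff (level_cut u a) [set x]).
Proof.
move=> nu; apply: left_lsc_measurable_fun => a c a01.
rewrite hausdorff_set1; last by apply: level_cut_nonempty => //; lra.
move=> ca; exists 0%R => [|b ba]; first lra.
apply: lt_le_trans (excess_le_hausdorff _ _); apply: lt_le_trans ca _.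
by apply: excess_mono => //; apply: level_cut_subset; lra.
Qed.

Lemma level_cut_radius u (M a : R) x : normal_fuzzy u -> (0 < a <= 1)%R ->
  N 0 1 (fun a => hausdorff (level_cut u a) [set 0%R]) <= M%:E ->
  level_cut u a x -> (euclid_dist x 0 <= M / a `^ p^-1)%R.
Proof.
move=> nu a01 uM ax; have mu := measurable_hausdorff_set1 0%R nu.
rewrite ler_pdivlMr; last by apply: powR_gt0; lra.
rewrite -lee_fin; apply: le_trans uM.
rewrite -[X in (_ * X `^ _)%R]subr0 -pnorm_itv_cstE ?euclid_dist_ge0//; last lra.
apply: (@le_trans _ _ (N 0 a (fun a => hausdorff (level_cut u a) [set 0%R]))); last first.
  by apply: le_pnorm_itv => //; lra.
apply: pnorm_le => //.
- apply: measurable_funS mu => // b /=; rewrite !in_itv/= => ?.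
  by apply/andP; lra.
- by move=> ? _; rewrite lee_fin euclid_dist_ge0.
- move=> b /=; rewrite in_itv/= => b0a; apply: le_trans (excess_le_hausdorff _ _).
  rewrite leNgt; apply/negP => ux_lt.
  have [|_ ->] := excess_lt ux_lt (a := x); last by rewrite ltxx.
  by apply: level_cut_subset ax; lra.
Qed.

Lemma integral_hausdorff0E u : normal_fuzzy u ->
  (\int[lebesgue_measure]_(a in `[0%R, 1%R])
     hausdorff (level_cut u a) [set 0%R] `^ p) `^ p^-1 =
  N 0 1 (fun a => hausdorff (level_cut u a) [set 0%R]).
Proof.
by move=> nu; rewrite -pnorm_itvcc//; exact: measurable_hausdorff_set1.
Qed.

Lemma dp_fuzzy_zeroE u : fuzzy_compact u ->
  dp p u (@fuzzy_zero R m) = N 0 1 (fun a => hausdorff (level_cut u a) [set 0%R]).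
Proof.
have fcz := FB_fuzzy_compact (fuzzy_zero_FB R m).
move=> fcu; rewrite (dpE fcu fcz).
apply: eq_pnorm => a /[!inE]/=; rewrite in_itv/= => a01.
by rewrite /cut_dist !subr0 level_cut_fuzzy_zero.
Qed.

Lemma FBp_fuzzy_compact u : FBp R m p u -> fuzzy_compact u.
Proof.
move=> [fu nu uu]; rewrite integral_hausdorff0E// => fin; split => // a a0.
set M := N 0 1 _ in fin.
have ME : M = (fine M)%:E by rewrite fineK// ge0_fin_numE// pnorm_ge0.
have [a1|a1] := leP a 1%R.
  exists (fine M / a `^ p^-1)%R => x ax; apply: level_cut_radius ax => //.
    by rewrite a0.
  by rewrite -ME.
exists 0%R => x; rewrite level_cutE//= => /(lt_le_trans a1).
by case/andP: (fu x) => _ ux; rewrite ltNge ux.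
Qed.

Lemma FBpP u : FBp R m p u <-> fuzzy_compact u /\ dp p u (@fuzzy_zero R m) < +oo.
Proof.
split=> [FBu|[fcu fin]].
  have fcu := FBp_fuzzy_compact FBu; split => //.
  by case: FBu => _ nu _; rewrite (integral_hausdorff0E nu) (dp_fuzzy_zeroE fcu).
case: (fcu) => fu nu uu _; split; [exact: fu|exact: nu|exact: uu|].
by rewrite (integral_hausdorff0E nu) -(dp_fuzzy_zeroE fcu).
Qed.

Lemma dp_lty u v : FBp R m p u -> FBp R m p v -> dp p u v < +oo.
Proof.
move=> /FBpP[fcu uoo] /FBpP[fcv voo].
have fc0 := FB_fuzzy_compact (fuzzy_zero_FB R m).
apply: le_lt_trans (dp_triangle fcu fc0 fcv) _.
by apply: lte_add_pinfty; [exact: uoo|rewrite dpC; exact: voo].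
Qed.

Lemma FB_FBp u : FB R m u -> FBp R m p u.
Proof.
move=> FBu; have fcu := FB_fuzzy_compact FBu; apply/FBpP; split => //.
case: (FBu) => _ nu _ [M uM]; rewrite dp_fuzzy_zeroE//.
apply: (@le_lt_trans _ _ (Num.max M 0)%:E); last exact: ltry.
have M0 : (0 <= Num.max M 0)%R by rewrite le_max lexx orbT.
have := pnorm_itv_cst p1 (a := 0) (b := 1) _ M0; rewrite subr0 => /(_ (lexx _)).
apply: le_trans; apply: pnorm_le => //.
- exact: measurable_hausdorff_set1.
- move=> a /=; rewrite in_itv/= => a01; apply: hausdorff_ge0.
  by apply: level_cut_nonempty => //; lra.
- move=> a /=; rewrite in_itv/= => a01.
  rewrite hausdorff_set1; last by apply: level_cut_nonempty => //; lra.
  apply: excess_le => x ax; exists 0%R => //; rewrite le_max uM//.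
  by apply: level_cut_subset ax; lra.
Qed.

End FuzzyMetric.

(** * Left modulus of a fuzzy set *)

Section LeftModulus.
Context (R : realType) (m : nat) (p : R).
Hypothesis p1 : 1 <= p.
Implicit Types (u v w : 'rV[R]_m -> R) (a b c h k s e : R).
Local Open Scope ereal_scope.
Local Notation N a b := (pnorm (@lebesgue_measure R) p `]a%R, b%R]).

Let p_gt0 : (0 < p)%R. Proof. exact: lt_le_trans p1. Qed.

Lemma left_modulus_perturb u v h : fuzzy_compact u -> fuzzy_compact v -> (0 <= h)%R ->
  N h 1 (cut_dist u u 0 h) <= dp p u v + N h 1 (cut_dist v v 0 h) + dp p u v.
Proof.
move=> fcu fcv h0; rewrite -addeA.
apply: (@le_trans _ _ (N h 1 (cut_dist u v 0 0) + N h 1 (cut_dist v u 0 h))).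
  by apply: pnorm_cut_dist_triangle => //; lra.
apply: leeD.
  by rewrite dpE//; apply: le_pnorm_itv => //; apply: measurable_cut_dist => //; lra.
apply: (@le_trans _ _ (N h 1 (cut_dist v v 0 h) + N h 1 (cut_dist v u h h))).
  by apply: pnorm_cut_dist_triangle => //; lra.
apply: leeD; first exact: lexx.
rewrite dpC (dpE p fcv fcu).
have := @pnorm_cut_dist_shift _ _ p v u 0%R 0%R h 0%R (1 - h)%R fcv fcu.
rewrite (add0r h) (_ : (1 - h + h)%R = 1%R); last lra.
move=> ->; [|lra|lra|lra|lra].
by apply: le_pnorm_itv => //; [lra|apply: measurable_cut_dist => //; lra].
Qed.

Lemma FB_cut_dist_le u : FB R m u -> exists2 c, (0 <= c)%R &
  forall h a, (0 <= h <= a)%R -> (a <= 1)%R -> cut_dist u u 0 h a <= c%:E.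
Proof.
move=> [fu nu uu [M uM]].
have cut0 a : (0 <= a <= 1)%R -> excess (level_cut u a) [set 0%R] <= M%:E.
  move=> a01; apply: excess_le => x ax; exists 0%R => //; apply: uM.
  by apply: level_cut_subset ax; lra.
have M0 : (0 <= M)%R.
  rewrite -lee_fin; apply: le_trans (cut0 0%R _); last by lra.
  by apply: excess_ge0; apply: level_cut_nonempty => //; lra.
exists (M + M)%R => [|h a ha a1]; first by rewrite addr_ge0.
have ne b : (0 <= b <= 1)%R -> level_cut u b !=set0 by exact: level_cut_nonempty.
have z0 : [set 0%R : 'rV[R]_m] !=set0 by exists 0%R.
have na : level_cut u (a - 0) !=set0 by apply: ne; lra.
have nh : level_cut u (a - h) !=set0 by apply: ne; lra.
rewrite /cut_dist; apply: le_trans (hausdorff_triangle na z0 nh) _.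
rewrite EFinD; apply: leeD; [|rewrite hausdorffC]; rewrite hausdorff_set1//;
  by apply: cut0; lra.
Qed.

Lemma FB_left_modulus u e : FB R m u -> (0 < e)%R ->
  exists2 d, (0 < d)%R & forall h, (0 <= h < d)%R -> N h 1 (cut_dist u u 0 h) < e%:E.
Proof.
move=> FBu e0; have fcu := FB_fuzzy_compact FBu; have [fu nu uu _] := fcu.
have [c c0 uc] := FB_cut_dist_le FBu.
pose H n : R := (n.+1%:R^-1)%R.
have H0 n : (0 < H n)%R by rewrite invr_gt0.
have H1 n : (H n <= 1)%R by rewrite invf_le1// ler1n.
have Hlt e' : (0 < e')%R -> \forall n \near \oo, (H n < e')%R.
  by move=> e'0; exact: near_infty_natSinv_lt (PosNum e'0).
pose I n : set R := `]H n, 1%R]%classic.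
pose D : set R := `]0%R, 1%R]%classic.
have IE n : D `&` I n = I n.
  by apply/setIidPr => x; rewrite /D/I/= !in_itv/= => ?; have := H0 n => ?; apply/andP; lra.
have mH n : measurable_fun (I n) (cut_dist u u 0 (H n)).
  by have := H0 n => ?; apply: measurable_cut_dist => //; lra.
pose F n x := ((cut_dist u u 0 (H n)) \_ (I n)) x `^ p.
have F0 n x : 0 <= F n x by exact: poweR_ge0.
have ucI n x : D x -> 0 <= (cut_dist u u 0 (H n) \_ (I n)) x <= c%:E.
  rewrite /D/= in_itv/= => x01; rewrite patchE; case: ifPn => [|_].
    have := H0 n => ?; rewrite inE /I/= in_itv/= => ?.
    by apply/andP; split; [apply: cut_dist_ge0 => //; lra|apply: uc; lra].
  by rewrite lexx lee_fin.
have Fc n x : D x -> F n x <= (c `^ p)%:E.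
  move=> Dx; have /andP[? ?] := ucI n x Dx.
  by rewrite -poweR_EFin; apply: le_poweR => //; exact: ltW.
have mF n : measurable_fun D (F n).
  apply: measurable_fun_poweR; apply/measurable_restrict => /=.
  - exact: measurable_itv.
  - exact: measurable_itv.
  - by rewrite IE.
have cvgF x : D x -> F n x @[n --> \oo] --> 0.
  move=> Dx; have Ffin n : F n x \is a fin_num.
    by rewrite ge0_fin_numE// (le_lt_trans (Fc n x Dx))// ltry.
  apply: cvg_EFin; first exact: nearW.
  apply/cvgr0Pnorm_lt => r r0.
  have r2 : (0 < (r / 2) `^ p^-1)%R by rewrite powR_gt0// divr_gt0.
  move: (Dx); rewrite /D/= in_itv/= => x01.
  have [|b bx ub] := level_cut_left fcu _ r2 (a := x); first by lra.
  have xb : (0 < x - b)%R by lra.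
  near=> n; rewrite /= ger0_norm ?fine_ge0// -lte_fin fineK//.
  apply: (@le_lt_trans _ _ (r / 2)%:E); last by rewrite lte_fin; lra.
  have -> : (r / 2)%:E = ((r / 2) `^ p^-1)%:E `^ p.
    by rewrite poweR_EFin -powRrM mulVf ?powRr1//; [lra|rewrite gt_eqF].
  have Hn : (H n < x - b)%R by near: n; exact: Hlt.
  have := H0 n => Hn0.
  apply: le_poweR; [exact: ltW|by case/andP: (ucI n x Dx)|].
  rewrite patchE; case: ifPn => [_|_]; last by rewrite lee_fin ltW.
  rewrite /cut_dist subr0; apply: hausdorff_le.
    apply: (@le_trans _ _ 0); last by rewrite lee_fin ltW.
    by apply: excess_subset0; apply: level_cut_subset; lra.
  by apply: le_trans ub; apply: excess_mono => //; apply: level_cut_subset; lra.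
have cvgI : \int[lebesgue_measure]_(x in D) F n x @[n --> \oo] --> 0.
  have := @dominated_cvg _ _ _ (@lebesgue_measure R) D _ F (cst 0) (cst (c `^ p)%:E).
  rewrite integral0; apply => //.
  - exact: measurable_itv.
  - apply/integrableP; split => //.
    rewrite (_ : (fun _ => _) = cst `|(c `^ p)%:E|)// integral_cst//=; last exact: measurable_itv.
    by rewrite lebesgue_measure_itv/= lte_fin ltr01 oppr0 adde0 mule1 ltry.
  - by move=> n x Dx; rewrite gee0_abs// Fc.
have e4 : (0 < e / 4)%R by rewrite divr_gt0.
have e4p : (0 < (e / 4) `^ p)%R by rewrite powR_gt0.
have [n [nI nH]] : exists n, \int[lebesgue_measure]_(x in D) F n x < ((e / 4) `^ p)%:E /\
    (H n < (e / 4 / (c + 1)) `^ p)%R.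
  apply: (@filter_ex _ \oo); near=> n; split; near: n.
    have /fine_cvgP[finI /cvgr0Pnorm_lt/(_ _ e4p) ltI] := cvgI.
    apply: filterS2 finI ltI => n finI; rewrite /= => ltI.
    by rewrite -(fineK finI) lte_fin; apply: le_lt_trans ltI; exact: ler_norm.
  by apply: Hlt; rewrite powR_gt0// !divr_gt0//; lra.
exists (H n) => // h hn; have := H0 n => Hn0; have := H1 n => Hn1.
apply: (@le_lt_trans _ _ ((e / 4)%:E + (e / 4)%:E)); last by rewrite -EFinD lte_fin; lra.
have mh a b : (h <= a)%R -> (b <= 1)%R -> measurable_fun `]a, b] (cut_dist u u 0 h).
  by move=> ? ?; apply: measurable_cut_dist => //; lra.
have hU : `]h, H n] `|` `]H n, 1%R] = `]h, 1%R]%classic :> set R.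
  by rewrite -itv_bndbnd_setU// bnd_simp; lra.
have split_le : N h 1 (cut_dist u u 0 h) <=
    N h (H n) (cut_dist u u 0 h) + N (H n) 1 (cut_dist u u 0 h).
  rewrite -hU; apply: pnorm_setU => //; rewrite hU.
    by apply: mh; lra.
  by move=> x; rewrite /= in_itv/= => ?; apply: cut_dist_fin => //; lra.
apply: le_trans split_le _.
apply: leeD.
  apply: (@le_trans _ _ (N h (H n) (cst c%:E))).
    apply: pnorm_le => //; first by apply: mh; lra.
      by move=> x /=; rewrite in_itv/= => ?; apply: cut_dist_ge0 => //; lra.
    by move=> x /=; rewrite in_itv/= => ?; apply: uc; lra.
  rewrite pnorm_itv_cstE//; last lra.
  rewrite lee_fin; apply: (@le_trans _ _ (c * (e / 4 / (c + 1)))%R).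
    rewrite ler_wpM2l//; have -> : (e / 4 / (c + 1) = ((e / 4 / (c + 1)) `^ p) `^ p^-1)%R.
      by rewrite -powRrM mulfV ?powRr1//; [rewrite !divr_ge0//; lra|rewrite gt_eqF].
    apply: ge0_ler_powR; rewrite ?nnegrE ?invr_ge0 ?powR_ge0 ?ltW//; lra.
  have c1 : (0 < c + 1)%R by lra.
  rewrite mulrA ler_pdivrMr// mulrC ler_pM2l//; lra.
have -> : (e / 4)%:E = ((e / 4) `^ p)%:E `^ p^-1.
  by rewrite poweR_EFin -powRrM mulfV ?powRr1//; [lra|rewrite gt_eqF].
apply: (@le_trans _ _ (pnorm lebesgue_measure p D (cut_dist u u 0 (H n) \_ (I n)))).
  rewrite (pnorm_restrict _ p1) IE; apply: pnorm_le => //; first by apply: mh; lra.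
    exact: mH.
    by move=> x; rewrite /I/= in_itv/= => ?; apply: cut_dist_ge0 => //; lra.
  move=> x; rewrite /I/= in_itv/= => ?; apply: hausdorff_le.
    apply: (@le_trans _ _ 0); last by apply: cut_dist_ge0 => //; lra.
    by apply: excess_subset0; apply: level_cut_subset; lra.
  rewrite /cut_dist hausdorffC; apply: le_trans (excess_le_hausdorff _ _).
  by apply: excess_mono => //; apply: level_cut_subset; lra.
apply: le_poweR; [by rewrite invr_ge0 ltW| |exact: ltW].
by apply: integral_ge0 => x _; exact: poweR_ge0.
Unshelve. all: by end_near. Qed.

End LeftModulus.

(** * Necessity *)

Section DpSpace.
Context (R : realType) (m : nat) (p : R) (X : set ('rV[R]_m -> R)).
Hypotheses (p1 : 1 <= p) (XFBp : X `<=` FBp R m p).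
Implicit Types (u v w : dp_space p X) (U : set ('rV[R]_m -> R)) (e : R).
Local Open Scope ereal_scope.

Let fcX (u : set_type X) : fuzzy_compact (\val u).
Proof. exact/(FBp_fuzzy_compact p1)/XFBp/set_valP. Qed.

Lemma dp_ball_nbhs u e : (0 < e)%R ->
  nbhs u [set v : dp_space p X | dp p (\val (u : set_type X)) (\val (v : set_type X)) < e%:E].
Proof.
move=> e0; set B := [set v | _].
have oB : metric_open (d := fun u v : set_type X => dp p (\val u) (\val v)) B.
  move=> v; rewrite /B/= => uv.
  have : dp p (\val (u : set_type X)) (\val (v : set_type X)) \is a fin_num.
    by rewrite ge0_fin_numE ?dp_ge0// (lt_trans uv)// ltry.
  move=> /fineK duv; exists (e - fine (dp p (\val (u : set_type X)) (\val (v : set_type X))))%R.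
    by rewrite subr_gt0 -lte_fin duv.
  move=> w vw; apply: le_lt_trans (dp_triangle p1 (fcX u) (fcX v) (fcX w)) _.
  by rewrite -duv addeC -lteBrDr// -EFinB.
rewrite nbhsE; exists B => //; split; first exact: oB.
by rewrite /B/= (dpxx p1 (fcX u)).
Qed.

Lemma dp_nbhs_ball u (B : set (dp_space p X)) : nbhs u B ->
  exists2 e, (0 < e)%R & forall v : dp_space p X,
    dp p (\val (u : set_type X)) (\val (v : set_type X)) < e%:E -> B v.
Proof.
rewrite nbhsE; case=> O [oO Ou] OB.
have [e e0 eO] : exists2 e, (0 < e)%R & forall v : dp_space p X,
    dp p (\val (u : set_type X)) (\val (v : set_type X)) < e%:E -> O v.
  have mO : metric_open (d := fun u v : set_type X => dp p (\val u) (\val v)) O.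
    exact: oO.
  exact: mO.
by exists e => // v /eO/OB.
Qed.

Lemma closure_dp_traceP U u : closure (dp_trace p X U) u <->
  forall e, (0 < e)%R -> exists2 v : set_type X,
    U (\val v) & dp p (\val (u : set_type X)) (\val v) < e%:E.
Proof.
split=> [ucl e /(dp_ball_nbhs u)/ucl[v [Uv uv]]|h B /dp_nbhs_ball[e e0 eB]].
  by exists v.
by have [v Uv uv] := h e e0; exists v; split => //; exact: eB.
Qed.

(* A compactness argument without finite subcovers: [A d] collects the elements
   of [U] violating a desired property at scale [d]. *)
Lemma compact_dp_cluster U (A : R -> set ('rV[R]_m -> R)) :
  U `<=` X -> compact (closure (dp_trace p X U)) ->
  (forall d, (0 < d)%R -> A d !=set0) -> (forall d, A d `<=` U) ->
  (forall d d', (0 < d <= d')%R -> A d `<=` A d') ->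
  exists2 w, X w & forall d e, (0 < d)%R -> (0 < e)%R ->
    exists2 u, A d u & dp p w u < e%:E.
Proof.
move=> UX cU A0 AU Amono.
pose F := filter_from [set d : R | (0 < d)%R] (fun d => dp_trace p X (A d)).
have FF : ProperFilter F.
  apply: filter_from_proper.
    apply: filter_from_filter; first by exists 1%R => /=.
    move=> i j /= i0 j0; exists (Num.min i j); first by rewrite /= lt_min i0 j0.
    by move=> u; rewrite /dp_trace/= => Au; split; apply: Amono Au;
      rewrite lt_min i0 j0 ge_min lexx ?orbT.
  move=> d /= /A0[u Au]; have Xu : u \in X by rewrite inE; exact/UX/(AU d).
  by exists (SigSub Xu : set_type X).
have FU : F (closure (dp_trace p X U)).
  exists 1%R => //=; apply: subset_trans (@subset_closure _ _) => u.
  exact: AU.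
have [w [_ Fw]] := cU F FF FU.
exists (\val (w : set_type X)); first exact: set_valP.
move=> d e d0 e0.
have [|u [Au wu]] := Fw (dp_trace p X (A d)) _ _ (dp_ball_nbhs w e0).
  by exists d.
by exists (\val (u : set_type X)).
Qed.

End DpSpace.

Section CompactNecessary.
Context (R : realType) (m : nat) (p : R) (U : set ('rV[R]_m -> R)).
Hypotheses (p1 : 1 <= p) (UFB : U `<=` FB R m).
Hypothesis cU : dp_relatively_compact p (FB R m) U.
Local Open Scope ereal_scope.

Let FBFBp : FB R m `<=` FBp R m p := fun u => FB_FBp p1 (u := u).
Let fcFB u (FBu : FB R m u) := FB_fuzzy_compact FBu.

Lemma relatively_compact_bounded : p_mean_bounded p U.
Proof.
apply: contrapT => noM.
have [|d /=||w FBw wU] := compact_dp_cluster p1 FBFBp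
    (A := fun d => [set u | U u /\ d^-1%:E < dp p u (@fuzzy_zero R m)]) UFB cU.
- move=> d d0; apply: contrapT => noA; apply: noM; exists d^-1%R; first by rewrite invr_gt0.
  by move=> u Uu; rewrite leNgt; apply/negP => ud; apply: noA; exists u.
- by move=> u [].
- move=> d d' /andP[d0 dd'] u /= [Uu ud]; split => //; apply: le_lt_trans ud.
  by rewrite lee_fin lef_pV2// posrE// (lt_le_trans d0).
have fc0 := fcFB (fuzzy_zero_FB R m).
have /fineK w0 : dp p w (@fuzzy_zero R m) \is a fin_num.
  by rewrite ge0_fin_numE ?dp_ge0// dp_lty//; apply: FB_FBp => //; exact: fuzzy_zero_FB.
pose r := fine (dp p w (@fuzzy_zero R m)).
have r0 : (0 <= r)%R by rewrite /r -lee_fin w0 dp_ge0.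
have [|u [Uu ru] wu] := wU (r + 1)^-1%R 1%R _ ltr01; first by rewrite invr_gt0; lra.
have := dp_triangle p1 (fcFB (UFB Uu)) (fcFB FBw) fc0.
rewrite leNgt => /negP; apply; apply: lt_trans ru; rewrite invrK EFinD addeC.
have <- : r%:E = dp p w (@fuzzy_zero R m) by exact: w0.
have uw1 : dp p u w < 1%:E by rewrite dpC; exact: wu.
by rewrite (lteD2rE _ _ (isT : r%:E \is a fin_num)); exact: uw1.
Qed.

Lemma relatively_compact_equi_left_continuous : p_mean_equi_left_continuous p U.
Proof.
move=> e e0; apply: contrapT => nod.
pose A d := [set u | U u /\ exists2 h, (0 <= h < d)%R &
  e%:E <= pnorm lebesgue_measure p `]h, 1%R] (cut_dist u u 0 h)].
have [d d0|d u []//|d d' dd' u [Uu [h hd eh]]|w FBw wU] :=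
    compact_dp_cluster p1 FBFBp (A := A) UFB cU.
- apply: contrapT => noA; apply: nod; exists d => // h u hd Uu.
  have h0 : (0 <= h)%R by case/andP: hd.
  rewrite left_modulusE//; last exact/fcFB/UFB.
  by rewrite ltNge; apply/negP => eh; apply: noA; exists u; split => //; exists h.
- by split => //; exists h => //; lra.
have e3 : (0 < e / 3)%R by lra.
have [d d0 wd] := FB_left_modulus p1 FBw e3.
have [u [Uu [h hd eh]] wu] := wU d (e / 3)%R d0 e3.
have h0 : (0 <= h)%R by case/andP: hd.
have := left_modulus_perturb p1 (fcFB (UFB Uu)) (fcFB FBw) h0.
move=> /(le_trans eh); rewrite leNgt => /negP; apply.
have -> : e%:E = (e / 3)%:E + (e / 3)%:E + (e / 3)%:E by rewrite -!EFinD; congr EFin; lra.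
by rewrite dpC; apply: lteD; [apply: lteD; [exact: wu|exact: wd]|exact: wu].
Qed.

Lemma relatively_compact_closure : dp_closure p (FBp R m p) U `<=` FB R m.
Proof.
move=> _ [v vcl <-].
have FBpv : FBp R m p (\val v) by exact: set_valP.
have [d d0|d u []//|d d' /andP[d0 dd'] u [Uu vu]|w FBw wU] := compact_dp_cluster p1 FBFBp
    (A := fun d => [set u | U u /\ dp p (\val v) u < d%:E]) UFB cU.
- have [u Uu vu] := (closure_dp_traceP p1 (fun u h => h) U v).1 vcl d d0.
  by exists (\val u).
- by split => //; rewrite (lt_le_trans vu)// lee_fin.
suff -> : \val v = w by [].
have fcv := FBp_fuzzy_compact p1 FBpv.
apply: (dp_eq0 p1) => //; first exact: fcFB.
apply/eqP; rewrite eq_le dp_ge0 andbT; apply/lee_addgt0Pr => e e0; rewrite add0e.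
have e2 : (0 < e / 2)%R by rewrite divr_gt0.
have [u [Uu vu] wu] := wU _ _ e2 e2.
apply: le_trans (dp_triangle p1 fcv (fcFB (UFB Uu)) (fcFB FBw)) _.
rewrite [e in leRHS](splitr e) EFinD; apply: leeD; first exact: ltW vu.
by rewrite dpC; exact: ltW wu.
Qed.

End CompactNecessary.

(** * Ultralimits of fuzzy sets *)

Section UltraLimit.
Context (R : realType) (m : nat) (T : Type) (F : set_system T) (u : T -> 'rV[R]_m -> R).
Hypothesis FU : UltraFilter F.
Hypothesis fcu : forall t, fuzzy_compact (u t).
Hypothesis bu : forall b, 0 < b <= 1 ->
  exists r, F [set t | forall x, level_cut (u t) b x -> euclid_dist x 0 <= r].
Implicit Types (a b c e s : R) (x y : 'rV[R]_m).

Let FF : Filter F.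
Proof. exact: (@ultra_proper _ _ FU). Qed.

Let FP : ProperFilter F.
Proof. exact: ultra_proper. Qed.

Definition ultra_cut b : set 'rV[R]_m :=
  [set x | forall e, 0 < e -> F [set t | exists2 y, level_cut (u t) b y & euclid_dist x y < e]].

Lemma ultra_cut_subset a b : 0 <= a <= b -> ultra_cut b `<=` ultra_cut a.
Proof.
move=> ab x bx e /bx; apply: filterS => t [y yb xy]; exists y => //.
exact: level_cut_subset yb.
Qed.

Lemma ultra_cut_closed b : closed (ultra_cut b).
Proof.
apply/closed_euclidP => x xcl e e0.
have e2 : 0 < e / 2 by rewrite divr_gt0.
have [y yb xy] := xcl _ e2; apply: filterS (yb _ e2) => t [z zb yz].
by exists z => //; have := euclid_dist_triangle y x z; lra.
Qed.

Lemma ultra_cut_bounded b : 0 < b <= 1 -> euclid_bounded (ultra_cut b).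
Proof.
move=> /bu[r Fr]; exists (r + 1) => x /(_ 1 ltr01) Fx.
have [t [/= tr [y yb xy]]] := filter_ex (filterI Fr Fx).
by have := tr y yb; have := euclid_dist_triangle y x 0; lra.
Qed.

Lemma ultra_excess_cut b e : 0 < b <= 1 -> 0 < e ->
  F [set t | (excess (level_cut (u t) b) (ultra_cut b) <= e%:E)%E].
Proof.
move=> b01 e0; have [//|Fbad] := in_ultra_setVsetC
  [set t | (excess (level_cut (u t) b) (ultra_cut b) <= e%:E)%E] FU.
have far t : exists y, ~ (excess (level_cut (u t) b) (ultra_cut b) <= e%:E)%E ->
    level_cut (u t) b y /\ forall k, ultra_cut b k -> e <= euclid_dist y k.
  apply: contrapT => nofar; apply: (nofar); exists 0 => noex; exfalso; apply: noex.
  apply: excess_le => y yb; apply: contrapT => nok; apply: nofar.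
  exists y => _; split => // k kb; rewrite leNgt; apply/negP => yk.
  by apply: nok; exists k => //; exact: ltW.
have [g gP] := choice far; have [r Fr] := bu b01.
have [|x xlim] := @ultra_bounded_limit _ _ _ F g r FU.
  by apply: filterS2 Fr Fbad => t /= tr /gP[gb _]; exact: tr.
have xb : ultra_cut b x.
  move=> e' /xlim Fe'; apply: filterS2 Fe' Fbad => t /= gx /gP[gb _].
  by exists (g t) => //; rewrite euclid_distC.
have [t [/= gx /gP[_ /(_ x xb)]]] := filter_ex (filterI (xlim e e0) Fbad).
by rewrite leNgt gx.
Qed.

Lemma ultra_cut_excess b e : 0 < b <= 1 -> 0 < e ->
  F [set t | (excess (ultra_cut b) (level_cut (u t) b) <= e%:E)%E].
Proof.
move=> b01 e0; have [//|Fbad] := in_ultra_setVsetC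
  [set t | (excess (ultra_cut b) (level_cut (u t) b) <= e%:E)%E] FU.
have far t : exists k, ~ (excess (ultra_cut b) (level_cut (u t) b) <= e%:E)%E ->
    ultra_cut b k /\ forall y, level_cut (u t) b y -> e <= euclid_dist k y.
  apply: contrapT => nofar; apply: (nofar); exists 0 => noex; exfalso; apply: noex.
  apply: excess_le => k kb; apply: contrapT => noy; apply: nofar.
  exists k => _; split => // y yb; rewrite leNgt; apply/negP => ky.
  by apply: noy; exists y => //; exact: ltW.
have [g gP] := choice far; have [r Fr] := ultra_cut_bounded b01.
have [|x xlim] := @ultra_bounded_limit _ _ _ F g r FU.
  by apply: filterS Fbad => t /= /gP[gb _]; exact: Fr.
have e4 : 0 < e / 4 by rewrite divr_gt0.
have [t0 [/= gx0 /gP[kb _]]] := filter_ex (filterI (xlim _ e4) Fbad).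
have [t [[/= gx /gP[_ far_t]] [y yb ky]]] :=
  filter_ex (filterI (filterI (xlim _ e4) Fbad) (kb _ e4)).
have := far_t y yb.
have := euclid_dist_triangle x (g t) y; have := euclid_dist_triangle (g t0) x y.
by rewrite (euclid_distC x (g t0)); lra.
Qed.

(* The value [0] is included only to keep the set nonempty. *)
Definition ultra_limit x : R :=
  sup [set b | b = 0 \/ (0 < b < 1 /\ ultra_cut b x)].

Let has_sup_limit x : has_sup [set b | b = 0 \/ (0 < b < 1 /\ ultra_cut b x)].
Proof.
split; first by exists 0; left.
by exists 1 => b /= [->//|[/andP[_ /ltW]]].
Qed.

Lemma ultra_limit_ge b x : 0 < b < 1 -> ultra_cut b x -> b <= ultra_limit x.
Proof. by move=> b01 xb; apply: sup_upper_bound => //; right. Qed.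

Lemma lt_ultra_limit b x : 0 <= b < ultra_limit x -> ultra_cut b x.
Proof.
move=> /andP[b0]; rewrite -subr_gt0 => bw.
have [c [cE|[c01 xc]]] := sup_adherent bw (has_sup_limit x).
  by rewrite cE /ultra_limit; lra.
by rewrite subKr => bc; apply: ultra_cut_subset xc; lra.
Qed.

Lemma level_cut_ultra_limit a b : 0 <= b < a -> level_cut ultra_limit a `<=` ultra_cut b.
Proof.
move=> ba x; rewrite level_cutE /=; last by lra.
by move=> xa; apply: lt_ultra_limit; lra.
Qed.

Lemma ultra_cut_level_cut b : 0 < b < 1 -> ultra_cut b `<=` level_cut ultra_limit b.
Proof.
by move=> b01 x xb; rewrite level_cutE /=; [exact: ultra_limit_ge|lra].
Qed.

Lemma ultra_limit_fuzzy_compact : fuzzy_compact ultra_limit.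
Proof.
have fw : fuzzy_set ultra_limit.
  move=> x; apply/andP; split.
    by apply: sup_upper_bound => //; left.
  by apply: ge_sup => [|b /= [->//|[/andP[_ /ltW]]]//]; exists 0; left.
split => //.
- have top t : exists x, u t x = 1 by case: (fcu t).
  have [g gP] := choice top.
  have [|r Fr] := bu (b := 1); first by rewrite ltr01 lexx.
  have [|x xlim] := @ultra_bounded_limit _ _ _ F g r FU.
    by apply: filterS Fr => t /= tr; apply: tr; rewrite level_cutE//= gP.
  exists x; apply/eqP; rewrite eq_le; have /andP[w0 ->] := fw x; rewrite /= leNgt.
  apply/negP => w1; pose b := (ultra_limit x + 1) / 2.
  have b01 : 0 < b < 1 by rewrite /b; lra.
  have : b <= ultra_limit x.
    apply: ultra_limit_ge => // e /xlim; apply: filterS => t /= gx.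
    exists (g t); last by rewrite euclid_distC.
    by rewrite level_cutE//= ?gP; lra.
  by rewrite /b; lra.
- move=> x a wa; have [a1|a1] := ltP 1 a.
    apply: filterS (nbhs_euclid x ltr01) => y _; apply: le_lt_trans a1.
    by case/andP: (fw y).
  pose c := (ultra_limit x + a) / 2.
  have /andP[w0 _] := fw x.
  have c01 : 0 < c < 1 by rewrite /c; lra.
  have [e e0 xe] : exists2 e, 0 < e & forall y, ultra_cut c y -> e <= euclid_dist x y.
    apply: contrapT => noe; have : ultra_cut c x.
      apply: (closed_euclidP _).1; first exact: ultra_cut_closed.
      move=> e e0; apply: contrapT => noy; apply: noe; exists e => // y cy.
      by rewrite leNgt; apply/negP => xy; apply: noy; exists y.
    by move=> /(ultra_limit_ge c01); rewrite /c; lra.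
  apply: filterS (nbhs_euclid x e0) => y xy; rewrite ltNge; apply/negP => ay.
  have : ultra_cut c y by apply: lt_ultra_limit; rewrite /c; lra.
  by move=> /xe; rewrite leNgt xy.
- move=> a a0; have [a1|a1] := leP a 1.
    have [|r br] := @ultra_cut_bounded (a / 2); first by lra.
    by exists r => x ax; apply: br; apply: level_cut_ultra_limit ax; lra.
  exists 0 => x; rewrite level_cutE//= => ax.
  by have := fw x; lra.
Qed.

Definition interleaved s e (v w : 'rV[R]_m -> R) : Prop :=
  forall a, s < a <= 1 ->
    (excess (level_cut w a) (level_cut v (a - s)) <= e%:E)%E /\
    (excess (level_cut v a) (level_cut w (a - s)) <= e%:E)%E.

Lemma ultra_limit_interleaved s e : 0 < s -> 0 < e ->
  F [set t | interleaved s e (u t) ultra_limit].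
Proof.
move=> s0 e0; pose N := (Num.bound s^-1).+1.
have N0 : 0 < N%:R :> R by rewrite ltr0n.
have Ns : N%:R^-1 <= s.
  rewrite -[leRHS]invrK lef_pV2 ?posrE ?invr_gt0// ltW//.
  have := archi_boundP (ltW (_ : 0 < s^-1)); rewrite invr_gt0 => /(_ s0) /lt_le_trans; apply.
  by rewrite ler_nat leqnSn.
pose P b t := (0 < b < 1) ->
  (excess (level_cut (u t) b) (ultra_cut b) <= e%:E)%E /\
  (excess (ultra_cut b) (level_cut (u t) b) <= e%:E)%E.
have Fgrid : F [set t | forall j : 'I_N, P (j%:R / N%:R) t].
  apply: filter_forall => j; rewrite /P.
  have [b01|nb] := boolP (0 < (j%:R / N%:R : R) < 1); last by apply: filterE => t b01; case/negP: nb.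
  have b01' : 0 < (j%:R / N%:R : R) <= 1 by lra.
  by apply: filterS2 (ultra_excess_cut b01' e0) (ultra_cut_excess b01' e0) => t /=.
apply: filterS Fgrid => t grid a sa.
have [j ja aj] : exists2 j : 'I_N, j%:R / N%:R < a & a - s <= j%:R / N%:R.
  have exj : exists j, a <= j.+1%:R / N%:R.
    by exists N.-1; rewrite prednK// divff ?gt_eqF//; lra.
  case: (ex_minnP exj) => j aj jmin.
  have ja : j%:R / N%:R < a.
    case: j jmin aj => [_ aj|j jmin _]; first by rewrite mul0r; lra.
    by rewrite ltNge; apply/negP => /jmin; rewrite ltnn.
  have jN : (j < N)%N.
    rewrite -(ltr_nat R) -[ltRHS]mul1r -ltr_pdivrMr//; lra.
  exists (Ordinal jN) => //=; move: aj; rewrite -addn1 natrD mulrDl; lra.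
have [|ub bu'] := grid j; first by lra.
split.
- apply: le_trans bu'; apply: excess_mono.
    by apply: level_cut_ultra_limit; lra.
  by apply: level_cut_subset; lra.
- apply: le_trans ub; apply: excess_mono; first by apply: level_cut_subset; lra.
  apply: (@subset_trans _ (level_cut ultra_limit (j%:R / N%:R))).
    by apply: ultra_cut_level_cut; lra.
  by apply: level_cut_subset; lra.
Qed.

End UltraLimit.

(** * Consequences of interleaving *)

Section Interleaving.
Context (R : realType) (m : nat) (p : R).
Hypothesis p1 : 1 <= p.
Implicit Types (u w : 'rV[R]_m -> R) (a b c h k s e : R).
Local Open Scope ereal_scope.
Local Notation N a b := (pnorm (@lebesgue_measure R) p `]a%R, b%R]).

Lemma pnorm_itv_leD a b e (f g h : R -> \bar R) :
  (b - a <= 1)%R -> (0 <= e)%R ->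
  measurable_fun `]a, b] f -> measurable_fun `]a, b] g -> measurable_fun `]a, b] h ->
  (forall x, (a < x <= b)%R -> 0 <= f x) ->
  (forall x, (a < x <= b)%R -> 0 <= g x < +oo) ->
  (forall x, (a < x <= b)%R -> 0 <= h x < +oo) ->
  (forall x, (a < x <= b)%R -> f x <= e%:E + (g x + h x)) ->
  N a b f <= e%:E + (N a b g + N a b h).
Proof.
move=> ab e0 mf mg mh f0 g0 h0 fgh.
have gh0 x : (a < x <= b)%R -> 0 <= g x + h x < +oo.
  by move=> xab; have [/andP[? ?] /andP[? ?]] := (g0 x xab, h0 x xab);
    rewrite adde_ge0//= lte_add_pinfty.
have mgh : measurable_fun `]a, b] (g \+ h) by exact: emeasurable_funD.
apply: (@le_trans _ _ (N a b (cst e%:E) + N a b (g \+ h))).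
  apply: pnormD => // x /=; rewrite in_itv//= => _.
  by rewrite lee_fin e0 ltry.
apply: leeD; first exact: pnorm_itv_cst.
by apply: pnormD => // x /=; rewrite in_itv//= => xab; case/andP: (gh0 x xab).
Qed.

Lemma interleaved_pnorm_zero s e u w : (0 < s < 1)%R -> (0 <= e)%R ->
  fuzzy_compact u -> fuzzy_compact w -> interleaved s e u w ->
  N s 1 (cut_dist w (@fuzzy_zero R m) 0 0) <= e%:E + dp p u (@fuzzy_zero R m).
Proof.
move=> s01 e0 fcu fcw uw; set z := @fuzzy_zero R m.
have fcz : fuzzy_compact z := FB_fuzzy_compact (fuzzy_zero_FB R m).
have [_ nu _ _] := fcu; have [_ nw _ _] := fcw.
apply: (@le_trans _ _ (N s 1 (cst e%:E) + N s 1 (cut_dist u z s s))).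
  apply: pnormD => //.
  - by apply: measurable_cut_dist => //; lra.
  - by apply: measurable_cut_dist => //; lra.
  - by move=> x /=; rewrite in_itv/= => ?; apply: cut_dist_ge0 => //; lra.
  - by move=> x _; rewrite lee_fin e0 ltry.
  - by move=> x /=; rewrite in_itv/= => ?; apply: cut_dist_fin => //; lra.
  - move=> x /=; rewrite in_itv/= => sx; rewrite /cut_dist subr0.
    rewrite !level_cut_fuzzy_zero; [|lra|lra].
    have wx : level_cut w x !=set0 by apply: level_cut_nonempty => //; lra.
    have ux : level_cut u (x - s) !=set0 by apply: level_cut_nonempty => //; lra.
    rewrite !hausdorff_set1//; apply: le_trans (excess_triangle _ wx ux) _.
    by apply: leeD => //; case: (uw x sx).
apply: leeD; first by apply: pnorm_itv_cst => //; lra.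
rewrite (dpE p fcu fcz); have := @pnorm_cut_dist_shift _ _ p u z 0%R 0%R s 0%R (1 - s)%R fcu fcz.
rewrite (add0r s) (_ : (1 - s + s)%R = 1%R); last lra.
move=> ->; [|lra|lra|lra|lra].
by apply: le_pnorm_itv => //; [lra|apply: measurable_cut_dist => //; lra].
Qed.

Lemma interleaved_left_modulus s e h u w : (0 < s < 1)%R -> (0 <= e)%R -> (0 <= h)%R ->
  fuzzy_compact u -> fuzzy_compact w -> interleaved s e u w ->
  N (h + s) (1 - s) (cut_dist w w 0 h) <=
  (e + e)%:E + N (h + s + s) 1 (cut_dist u u 0 (h + s + s)).
Proof.
move=> s01 e0 h0 fcu fcw uw; have [_ nu _ _] := fcu; have [_ nw _ _] := fcw.
apply: (@le_trans _ _ (N (h + s) (1 - s) (cst (e + e)%:E) +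
                       N (h + s) (1 - s) (cut_dist u u (- s) (h + s)))).
  apply: pnormD => //.
  - by apply: measurable_cut_dist => //; lra.
  - by apply: measurable_cut_dist => //; lra.
  - by move=> x /=; rewrite in_itv/= => ?; apply: cut_dist_ge0 => //; lra.
  - by move=> x _; rewrite lee_fin addr_ge0//= ltry.
  - by move=> x /=; rewrite in_itv/= => ?; apply: cut_dist_fin => //; lra.
  - move=> x /=; rewrite in_itv/= => hx.
    have wx : level_cut w (x - h) !=set0 by apply: level_cut_nonempty => //; lra.
    have ux : level_cut u (x - (h + s)) !=set0 by apply: level_cut_nonempty => //; lra.
    have ux' : level_cut u (x - - s) !=set0 by apply: level_cut_nonempty => //; lra.
    have rhs0 : 0 <= (e + e)%:E + cut_dist u u (- s) (h + s) x.
      rewrite adde_ge0 ?lee_fin ?addr_ge0//; apply: cut_dist_ge0 => //; lra.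
    rewrite {1}/cut_dist subr0; apply: hausdorff_le.
      by apply: le_trans rhs0; apply: excess_subset0; apply: level_cut_subset; lra.
    apply: le_trans (excess_triangle _ wx ux) _; rewrite EFinD -addeA; apply: leeD.
      have [|+ _] := uw (x - h)%R; first by lra.
      by rewrite (_ : (x - h - s = x - (h + s))%R); last by lra.
    apply: le_trans (excess_triangle _ ux ux') _; rewrite addeC; apply: leeD.
      by rewrite /cut_dist hausdorffC; exact: excess_le_hausdorff.
    have [|_] := uw (x - - s)%R; first by lra.
    by rewrite (_ : (x - - s - s = x)%R); last by lra.
apply: leeD; first by apply: pnorm_itv_cst => //; rewrite ?addr_ge0//; lra.
have := @pnorm_cut_dist_shift _ _ p u u (- s)%R (h + s)%R s (h + s)%R (1 - s)%R fcu fcu.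
rewrite (_ : (1 - s + s)%R = 1%R); last lra.
rewrite (_ : (- s + s)%R = 0%R); last lra.
by move=> ->//; lra.
Qed.

Lemma interleaved_dp_le s e u w : (0 < s <= 1 / 2)%R -> (0 <= e)%R ->
  fuzzy_compact u -> fuzzy_compact w -> interleaved s e u w ->
  dp p u w <= e%:E + (N s 1 (cut_dist u u 0 s) + N s 1 (cut_dist w w 0 s)) +
              (e%:E + (N s 1 (cut_dist u u 0 s) + N s 1 (cut_dist w w 0 s))).
Proof.
move=> s01 e0 fcu fcw uw; have [_ nu _ _] := fcu; have [_ nw _ _] := fcw.
have ne v a : normal_fuzzy v -> (0 <= a <= 1)%R -> level_cut v a !=set0.
  by move=> nv a01; exact: level_cut_nonempty.
rewrite dpE//.
(* On the lower half of the levels compare upwards, on the upper half downwards,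
   so that no level leaves [[0, 1]]. *)
have h01 : `]0%R, 1%R]%classic = `]0%R, (1 / 2)%R]%classic `|` `](1 / 2)%R, 1%R]%classic :> set R.
  by rewrite -itv_bndbnd_setU// bnd_simp; lra.
have split_le : N 0 1 (cut_dist u w 0 0) <=
    N 0 (1 / 2) (cut_dist u w 0 0) + N (1 / 2) 1 (cut_dist u w 0 0).
  rewrite h01; apply: pnorm_setU => //; rewrite -h01; first by apply: measurable_cut_dist => //; lra.
  by move=> x; rewrite /= in_itv/= => ?; apply: cut_dist_fin => //; lra.
apply: le_trans split_le _; apply: leeD.
  have sh v : fuzzy_compact v -> N 0 (1 / 2) (cut_dist v v (- s) 0) <= N s 1 (cut_dist v v 0 s).
    move=> fcv; have := @pnorm_cut_dist_shift _ _ p v v (- s)%R 0%R s 0%R (1 / 2)%R fcv fcv.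
    rewrite (_ : (- s + s)%R = 0%R); last lra.
    rewrite (add0r s) => <-; [|lra|lra|lra|lra].
    by apply: le_pnorm_itv => //; [lra|apply: measurable_cut_dist => //; lra].
  apply: (@le_trans _ _ (e%:E + (N 0 (1 / 2) (cut_dist u u (- s) 0) +
                                 N 0 (1 / 2) (cut_dist w w (- s) 0)))).
    apply: pnorm_itv_leD => //.
- lra.
- by apply: measurable_cut_dist => //; lra.
- by apply: measurable_cut_dist => //; lra.
- by apply: measurable_cut_dist => //; lra.

    - by move=> x x01; apply: cut_dist_ge0 => //; lra.
    - by move=> x x01; apply: cut_dist_fin => //; lra.
    - by move=> x x01; apply: cut_dist_fin => //; lra.
    move=> x x01.
    have uu0 : 0 <= cut_dist u u (- s) 0 x by apply: cut_dist_ge0 => //; lra.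
    have ww0 : 0 <= cut_dist w w (- s) 0 x by apply: cut_dist_ge0 => //; lra.
    have [|wu' uw'] := uw (x - - s)%R; first by lra.
    move: wu' uw'; rewrite (_ : (x - - s - s = x)%R) => [wu' uw'|]; last by lra.
    rewrite {1}/cut_dist !subr0; apply: hausdorff_le.
      apply: (@le_trans _ _ (excess (level_cut u x) (level_cut u (x - - s)) +
                             excess (level_cut u (x - - s)) (level_cut w x))).
        by apply: excess_triangle; apply: ne => //; lra.
      rewrite addeC; apply: leeD => //; apply: (@le_trans _ _ (cut_dist u u (- s) 0 x)).
        by rewrite /cut_dist subr0 hausdorffC; exact: excess_le_hausdorff.
      by rewrite leeDl.
    apply: (@le_trans _ _ (excess (level_cut w x) (level_cut w (x - - s)) +
                           excess (level_cut w (x - - s)) (level_cut u x))).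
      by apply: excess_triangle; apply: ne => //; lra.
    rewrite addeC; apply: leeD => //; apply: (@le_trans _ _ (cut_dist w w (- s) 0 x)).
      by rewrite /cut_dist subr0 hausdorffC; exact: excess_le_hausdorff.
    by rewrite leeDr.
  by apply: leeD; [exact: lexx|apply: leeD; [exact: sh fcu|exact: sh fcw]].
have sh v : fuzzy_compact v -> N (1 / 2) 1 (cut_dist v v 0 s) <= N s 1 (cut_dist v v 0 s).
  by move=> fcv; apply: le_pnorm_itv => //; [lra|apply: measurable_cut_dist => //; lra].
apply: (@le_trans _ _ (e%:E + (N (1 / 2) 1 (cut_dist u u 0 s) +
                               N (1 / 2) 1 (cut_dist w w 0 s)))).
  apply: pnorm_itv_leD => //.
- by apply: measurable_cut_dist => //; lra.
- by apply: measurable_cut_dist => //; lra.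
- by apply: measurable_cut_dist => //; lra.

  - by move=> x x01; apply: cut_dist_ge0 => //; lra.
  - by move=> x x01; apply: cut_dist_fin => //; lra.
  - by move=> x x01; apply: cut_dist_fin => //; lra.
  move=> x x01.
  have uu0 : 0 <= cut_dist u u 0 s x by apply: cut_dist_ge0 => //; lra.
  have ww0 : 0 <= cut_dist w w 0 s x by apply: cut_dist_ge0 => //; lra.
  have [|wu' uw'] := uw x; first by lra.
  rewrite {1}/cut_dist !subr0; apply: hausdorff_le.
    apply: (@le_trans _ _ (excess (level_cut u x) (level_cut w (x - s)) +
                           excess (level_cut w (x - s)) (level_cut w x))).
      by apply: excess_triangle; apply: ne => //; lra.
    apply: leeD => //; apply: (@le_trans _ _ (cut_dist w w 0 s x)).
      by rewrite /cut_dist subr0 hausdorffC; exact: excess_le_hausdorff.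
    by rewrite leeDr.
  apply: (@le_trans _ _ (excess (level_cut w x) (level_cut u (x - s)) +
                         excess (level_cut u (x - s)) (level_cut u x))).
    by apply: excess_triangle; apply: ne => //; lra.
  apply: leeD => //; apply: (@le_trans _ _ (cut_dist u u 0 s x)).
    by rewrite /cut_dist subr0 hausdorffC; exact: excess_le_hausdorff.
  by rewrite leeDl.
by apply: leeD; [exact: lexx|apply: leeD; [exact: sh fcu|exact: sh fcw]].
Qed.

End Interleaving.

(** * Sufficiency *)

Section CompactSufficient.
Context (R : realType) (m : nat) (p : R) (U : set ('rV[R]_m -> R)).
Hypotheses (p1 : 1 <= p) (UFB : U `<=` FB R m).
Hypothesis bU : p_mean_bounded p U.
Hypothesis eU : p_mean_equi_left_continuous p U.
Hypothesis clU : dp_closure p (FBp R m p) U `<=` FB R m.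
Local Open Scope ereal_scope.
Local Notation N a b := (pnorm (@lebesgue_measure R) p `]a%R, b%R]).

Let FBFBp : FB R m `<=` FBp R m p := fun u => FB_FBp p1 (u := u).
Let fcFB u (FBu : FB R m u) := FB_fuzzy_compact FBu.

Let V : set ('rV[R]_m -> R) := [set v | FB R m v /\
  forall e, (0 < e)%R -> exists2 u, U u & dp p v u < e%:E].

Lemma closure_bounded : exists2 M : R, (0 < M)%R &
  forall v, V v -> dp p v (@fuzzy_zero R m) <= M%:E.
Proof.
have [M M0 UM] := bU; exists (M + 1)%R => [|v [FBv vU]]; first by lra.
have [u Uu vu] := vU 1%R ltr01.
have fc0 := fcFB (fuzzy_zero_FB R m).
apply: le_trans (dp_triangle p1 (fcFB FBv) (fcFB (UFB Uu)) fc0) _.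
by rewrite addrC EFinD; apply: leeD; [exact: UM|exact: ltW].
Qed.

Lemma closure_equi_left_continuous e : (0 < e)%R -> exists2 d, (0 < d)%R &
  forall h v, (0 <= h < d)%R -> V v -> N h 1 (cut_dist v v 0 h) <= e%:E.
Proof.
move=> e0; have e3 : (0 < e / 3)%R by lra.
have [d d0 Ud] := eU e3; exists d => // h v hd [FBv /(_ _ e3)[u Uu vu]].
have h0 : (0 <= h)%R by case/andP: hd.
have fcu := fcFB (UFB Uu); have fcv := fcFB FBv.
apply: le_trans (left_modulus_perturb p1 fcv fcu h0) _.
have -> : e%:E = (e / 3)%:E + (e / 3)%:E + (e / 3)%:E by rewrite -!EFinD; congr EFin; lra.
apply: leeD; last exact: ltW.
apply: leeD; first exact: ltW.
rewrite -(left_modulusE p fcu h0); apply: ltW; exact: Ud hd Uu.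
Qed.

Section UltraLimitOfClosure.
Variables (T : Type) (F : set_system T) (v : T -> 'rV[R]_m -> R).
Hypotheses (FU : UltraFilter F) (FBv : forall t, FB R m (v t)).
Hypothesis FV : F [set t | V (v t)].

Let FP : ProperFilter F. Proof. exact: ultra_proper. Qed.
Let fcv t : fuzzy_compact (v t) := fcFB (FBv t).
Let w := ultra_limit F v.

Let level_cut_v_bounded b : (0 < b <= 1)%R ->
  exists r, F [set t | forall x, level_cut (v t) b x -> (euclid_dist x 0 <= r)%R].
Proof.
move=> b01; have [M M0 VM] := closure_bounded.
exists (M / b `^ p^-1)%R; apply: filterS FV => t /VM; rewrite dp_fuzzy_zeroE// => vM x.
by apply: level_cut_radius => //; case: (fcv t).
Qed.

Let fcw : fuzzy_compact w.
Proof. exact: ultra_limit_fuzzy_compact. Qed.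

Let interleaved_v s e : (0 < s)%R -> (0 < e)%R ->
  exists t, V (v t) /\ interleaved s e (v t) w.
Proof.
move=> s0 e0.
have Fi := ultra_limit_interleaved FU level_cut_v_bounded s0 e0.
by have [t] := filter_ex (filterI FV Fi); exists t.
Qed.

Lemma ultra_limit_FBp : FBp R m p w.
Proof.
apply/FBpP => //; split => //; have [M M0 VM] := closure_bounded.
apply: (@le_lt_trans _ _ (1 + M%:E)); last by rewrite -EFinD ltry.
have fc0 := fcFB (fuzzy_zero_FB R m).
rewrite dpE//; apply: (pnorm_itv_le p1 ltr01); first by apply: measurable_cut_dist => //; lra.
move=> s s01; have [s0 s1] := andP s01; have [t [Vt vw]] := interleaved_v s0 ltr01.
apply: le_trans (leeD (lexx _) (VM _ Vt)).
apply: le_trans (interleaved_pnorm_zero p1 s01 ler01 (fcv t) fcw vw).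
by apply: le_pnorm_itv => //; [lra|lra|apply: measurable_cut_dist => //; lra].
Qed.

Lemma ultra_limit_left_modulus e : (0 < e)%R -> exists2 d, (0 < d)%R &
  forall h, (0 <= h < d)%R -> N h 1 (cut_dist w w 0 h) <= e%:E.
Proof.
move=> e0; have e2 : (0 < e / 2)%R by lra.
have e4 : (0 < e / 4)%R by lra.
have [d d0 Vd] := closure_equi_left_continuous e2; exists d => // h hd.
have s0 : (0 < Num.min ((d - h) / 2) 1)%R by rewrite lt_min ltr01 andbT; lra.
apply: (pnorm_itv_le p1 s0); first by apply: measurable_cut_dist => //; lra.
move=> s; rewrite lt_min => hs.
have [||t [Vt vw]] := @interleaved_v s (e / 4)%R; [lra|lra|].
apply: le_trans (@interleaved_left_modulus _ _ _ p1 s (e / 4)%R h (v t) w _ _ _ _ _ vw) _ => //.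
- lra.
- lra.
- lra.
have -> : e%:E = (e / 4 + e / 4)%:E + (e / 2)%:E by rewrite -EFinD; congr EFin; lra.
by apply: leeD => //; apply: Vd => //; lra.
Qed.

Lemma ultra_limit_cvg e : (0 < e)%R -> F [set t | dp p (v t) w < e%:E].
Proof.
move=> e0; have e8 : (0 < e / 8)%R by lra.
have [d d0 Vd] := closure_equi_left_continuous e8.
have [d' d'0 wd] := ultra_limit_left_modulus e8.
pose s := (Num.min (Num.min d d') 1 / 2)%R.
have mn0 : (0 < Num.min (Num.min d d') 1)%R by rewrite !lt_min d0 d'0 ltr01.
have : (Num.min (Num.min d d') 1 <= Num.min (Num.min d d') 1)%R by [].
rewrite {1}le_min le_min => /andP[/andP[sd sd'] s1].
have s0 : (0 < s <= 1 / 2)%R by rewrite /s; lra.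
have s00 : (0 < s)%R by lra.
have Fi := ultra_limit_interleaved FU level_cut_v_bounded s00 e8.
apply: filterS2 FV Fi => t Vt vw /=.
apply: le_lt_trans (interleaved_dp_le p1 s0 (ltW e8) (fcv t) fcw vw) _.
have c_le : (e / 8)%:E + (N s 1 (cut_dist (v t) (v t) 0 s) + N s 1 (cut_dist w w 0 s)) <=
    (3 * (e / 8))%:E.
  have -> : (3 * (e / 8))%:E = (e / 8)%:E + ((e / 8)%:E + (e / 8)%:E) :> \bar R.
    by rewrite -!EFinD; congr EFin; lra.
  apply: leeD => //; apply: leeD; first by apply: Vd => //; rewrite /s; lra.
  by apply: wd; rewrite /s; lra.
by apply: le_lt_trans (leeD c_le c_le) _; rewrite -EFinD lte_fin; lra.
Qed.

Lemma ultra_limit_FB : FB R m w.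
Proof.
apply: clU; have Xw : w \in FBp R m p by rewrite inE; exact: ultra_limit_FBp.
exists (SigSub Xw : set_type (FBp R m p)) => //.
apply/(closure_dp_traceP p1 (fun u h => h)) => e e0.
have e2 : (0 < e / 2)%R by lra.
have [t [/= [_ /(_ _ e2)[u Uu vu]] vw]] := filter_ex (filterI FV (ultra_limit_cvg e2)).
have Xu : u \in FBp R m p by rewrite inE; exact/FBFBp/UFB.
exists (SigSub Xu : set_type (FBp R m p)) => //=.
apply: le_lt_trans (dp_triangle p1 fcw (fcv t) (fcFB (UFB Uu))) _.
have -> : e%:E = (e / 2)%:E + (e / 2)%:E by rewrite -EFinD -splitr.
by apply: lteD; [rewrite dpC; exact: vw|exact: vu].
Qed.

End UltraLimitOfClosure.

Lemma relatively_compact_sufficient : dp_relatively_compact p (FB R m) U.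
Proof.
rewrite /dp_relatively_compact compact_ultra => F FU FV.
pose v (t : dp_space p (FB R m)) := \val (t : set_type (FB R m)).
have FBv t : FB R m (v t) by exact: set_valP.
have FVv : F [set t | V (v t)].
  have FF : Filter F by exact: (@ultra_proper _ _ FU).
  apply: filterS FV => t /(closure_dp_traceP p1 FBFBp) tU; split => // e /tU[u Uu tu].
  by exists (\val u).
have lim := ultra_limit_cvg FU FBv FVv.
have Xw : ultra_limit F v \in FB R m by rewrite inE; exact: (ultra_limit_FB FU FBv FVv).
pose w : dp_space p (FB R m) := (SigSub Xw : set_type (FB R m)).
have Fw : F --> w.
  have FF : Filter F by exact: (@ultra_proper _ _ FU).
  move=> B /dp_nbhs_ball[e e0 eB]; apply: filterS (lim e e0) => t vw.
  by apply: eB; rewrite dpC.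
exists w; split => //.
have FP : ProperFilter F by exact: ultra_proper.
apply: closed_closure => B wB.
have [x [xU Bx]] := filter_ex (filterI FV (Fw B wB)); by exists x.
Qed.

End CompactSufficient.

Theorem theorem5p5 (R : realType) (m : nat) (p : R)
    (U : set ('rV[R]_m -> R)) :
  (1 <= m)%N -> 1 <= p -> U `<=` FB R m ->
  dp_relatively_compact p (FB R m) U <->
  [/\ p_mean_bounded p U,
      p_mean_equi_left_continuous p U
    & dp_closure p (FBp R m p) U `<=` FB R m].
Proof.
move=> _ p1 UFB; split=> [cU|[bU eU clU]].
  split; first exact: relatively_compact_bounded.
    exact: relatively_compact_equi_left_continuous.
  exact: relatively_compact_closure.
exact: relatively_compact_sufficient.
Qed.
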